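(* Let $r\in\mathbb N$, $1\le q\le\infty$, and let $k_1,k_2$ be integers and $\alpha$ real with $0\le k_1<\alpha<k_2\le r$. Then $$(\mathbf E,\mathbf E^r)^K_{\alpha/r,q}=(\mathbf E^{k_1},\mathbf E^{k_2})^K_{(\alpha-k_1)/(k_2-k_1),q}$$ as sets, with equivalent norms.
   Context: Let $G=\mathbb R_+\times\mathbb R$ be the ''$ax+b$'' group with multiplication $(a_1,b_1)(a_2,b_2)=(a_1a_2,\,a_1b_2+b_1)$. Let $T$ be a strongly continuous representation of $G$ in a Banach space $\mathbf E$ with $\|T(g)f\|_{\mathbf E}\le\|f\|_{\mathbf E}$. Put $T_1(t)=T(e^{t},0)$, $T_2(t)=T(1,t)$, with (closed) generators $\mathbb A_1,\mathbb A_2$. For $r\in\mathbb N$, $\mathbf E^{r}$ is the space of $f\in\mathbf E$ for which all products $\mathbb A_{j_1}\cdots\mathbb A_{j_k}f$, $1\le k\le r$, $j_i\in\{1,2\}$, are defined, with norm $\|f\|_{\mathbf E^r}=\|f\|_{\mathbf E}+\sum_{k=1}^r\sum_{(j_1,\dots,j_k)\in\{1,2\}^k}\|\mathbb A_{j_1}\cdots\mathbb A_{j_k}f\|_{\mathbf E}$; $\mathbf E^0=\mathbf E$. For Banach spaces $\mathbf E^{k_2}\subset\mathbf E^{k_1}$, the $K$-functional is $K(t,f,\mathbf E^{k_1},\mathbf E^{k_2})=\inf\{\|f_0\|_{\mathbf E^{k_1}}+t\|f_1\|_{\mathbf E^{k_2}}: f=f_0+f_1\}$, and for $0<\theta<1$,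 $1\le q\le\infty$, the interpolation space $(\mathbf E^{k_1},\mathbf E^{k_2})^K_{\theta,q}$ is the set of $f\in\mathbf E^{k_1}$ with finite norm $\big(\int_0^\infty(t^{-\theta}K(t,f,\mathbf E^{k_1},\mathbf E^{k_2}))^q\frac{dt}{t}\big)^{1/q}$ (with supremum for $q=\infty$). *)

(* Defs.v *)
From HB Require Import structures.
From mathcomp Require Import all_boot all_order all_algebra.
From mathcomp Require Import all_classical all_reals all_analysis.
Set Implicit Arguments. Unset Strict Implicit. Unset Printing Implicit Defensive.
Import Order.TTheory GRing.Theory Num.Theory.
Import numFieldNormedType.Exports.
Local Open Scope classical_set_scope.
Local Open Scope ring_scope.

Section AxB.
Variables (R : realType) (E : completeNormedModType R).

(* T a b = T(a,b) for the element (a,b) of the ax+b group (a > 0). *)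
Definition is_axb_contraction_rep (T : R -> R -> E -> E) : Prop :=
  [/\ (forall a b, 0 < a -> forall x y, T a b (x + y) = T a b x + T a b y),
      (forall a b, 0 < a -> forall (c : R) x, T a b (c *: x) = c *: T a b x),
      (forall x, T 1 0 x = x) &
      (forall a1 b1 a2 b2, 0 < a1 -> 0 < a2 -> forall x,
          T a1 b1 (T a2 b2 x) = T (a1 * a2) (a1 * b2 + b1) x)] /\
  ((forall a b, 0 < a -> forall x, `|T a b x| <= `|x|) /\
      (forall x, {within [set g : R * R | 0 < g.1],
                    continuous (fun g : R * R => T g.1 g.2 x)})).

(* the one-parameter groups T_1(t) = T(e^t, 0), T_2(t) = T(1, t);
   index true = 1, false = 2 *)
Definition T12 (T : R -> R -> E -> E) (j : bool) (t : R) : E -> E :=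
  if j then T (expR t) 0 else T 1 t.

Definition gen_graph (S : R -> E -> E) (f g : E) : Prop :=
  (fun t : R => t^-1 *: (S t f - f)) @ 0^' --> g.

(* graph of A_{j_1} ... A_{j_k} for w = [:: j_1; ...; j_k]
   (A_{j_k} is applied first) *)
Fixpoint word_graph (T : R -> R -> E -> E) (w : seq bool) (f g : E) : Prop :=
  match w with
  | [::] => g = f
  | j :: w' => exists h, word_graph T w' f h /\ gen_graph (T12 T j) h g
  end.

Definition word_op (T : R -> R -> E -> E) (w : seq bool) (f : E) : E :=
  xget 0 [set g | word_graph T w f g].

Definition Er (T : R -> R -> E -> E) (r : nat) : set E :=
  [set f | forall w : seq bool, (size w <= r)%N -> exists g, word_graph T w f g].

Definition Er_norm (T : R -> R -> E -> E) (r : nat) (f : E) : R :=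
  `|f| + \sum_(1 <= k < r.+1) \sum_(w : k.-tuple bool) `|word_op T (tval w) f|.

Definition Kfun (T : R -> R -> E -> E) (k1 k2 : nat) (t : R) (f : E) : R :=
  inf [set x : R | exists f0 f1 : E, [/\ Er T k1 f0, Er T k2 f1, f = f0 + f1 &
        x = Er_norm T k1 f0 + t * Er_norm T k2 f1]].

Definition interp_norm (T : R -> R -> E -> E) (k1 k2 : nat) (theta : R)
    (q : \bar R) (f : E) : \bar R :=
  match q with
  | +oo%E => ereal_sup [set ((t `^ (- theta)) * Kfun T k1 k2 t f)%:E
                       | t in `]0, +oo[%classic]
  | (q'%:E)%E => poweR (\int[lebesgue_measure]_(t in `]0, +oo[%classic)
                   ((((t `^ (- theta)) * Kfun T k1 k2 t f) `^ q') / t)%:E)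
                  q'^-1
  | -oo%E => +oo%E
  end.

Definition interp_space (T : R -> R -> E -> E) (k1 k2 : nat) (theta : R)
    (q : \bar R) : set E :=
  [set f | Er T k1 f /\ (interp_norm T k1 k2 theta q f < +oo)%E].

End AxB.

(* Main.v *)
Require Import Defs.
From HB Require Import structures.
From mathcomp Require Import all_boot all_order all_algebra.
From mathcomp Require Import all_classical all_reals all_analysis.
From mathcomp Require Import measurable_realfun.
From mathcomp Require Import ring lra.
Import Order.TTheory GRing.Theory Num.Theory.
Import numFieldNormedType.Exports.
Local Open Scope classical_set_scope.
Local Open Scope ring_scope.

(** The idea: write N_k for the norm of E^k and A_j for the two generators.

    1. Bernstein/Landau side: |A_j g| <= (2/t)|g| + 3t|A_j^2 g| for a group of
       isometries, so N_k <= C (t^-1 N_{k-1} + t N_{k+1}); by induction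
       t^k N_k f <= C (|f| + t^r N_r f) on E^r.

    2. Jackson side: let M_j be the average of T_j over [0, t] and S = M_1 M_2.
       From A_2 T(a,b) = a^-1 T(a,b) A_2 and
       A_1 T(a,b) = T(a,b) (A_1 + (b/a) A_2), an average of T along a curve
       (exp(sigma(s)), b(s)) with a scalar weight is carried by A_1 and A_2 to
       averages of the same kind.  Hence N_{k+1}(S f) <= (C/t) N_k f and
       N_k(f - S f) <= C t N_{k+1} f, and applying I - S^r repeatedly to
       f in E^k gives f_1 in E^r with |f - f_1| + t^r N_r f_1 <= C t^k N_k f.

    3. Reiteration: by 2, K(s^r; E, E^r) <= C s^k1 K(s^(k2-k1); E^k1, E^k2).
       Conversely, near-optimal approximants h_n of f at the scales 2^n s
       telescope, and 1 bounds N_k (h_n - h_{n+1}); the series converge in E^k1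
       as n -> -oo (E^k1 is complete because the generators are closed) and in
       E^k2 as n -> +oo, because s^-alpha K(s^r) is controlled and
       k1 < alpha < k2.  The passage to the weighted norms uses the invariance
       of dt/t under t -> c t and t -> t^n. *)

Set Implicit Arguments.
Unset Strict Implicit.
Unset Printing Implicit Defensive.

(** * Identities in modules *)

Section LmodReflection.
Context (R : comPzRingType) (V : lmodType R).

(** The norm N_k contains all lower orders, so it has no dilation homogeneity, and the estimates at
    scale t carry content only for t <= 1. For t > 1 they follow from the monotonicity of N_k in k,
    with 0 as the approximant on the Jackson side.

    A_1 does not commute with an average: it leaves a term in A_2 with a new weight. The estimates
    are therefore proved for all weighted averages along curves, a class closed under both
    generators, and are specialised to M_1 and M_2 afterwards.

    Averages are limits of dyadic Riemann sums, and the generator is described by an inequality in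
    place of a difference quotient. Statements about A_j of an integral thus reduce to finite sums
    and closedness.

    The reiteration is proved pointwise in s, and the assumed bounds on K carry a slack factor mu^n
    with mu < 1. The strict inequalities k1 < alpha < k2 leave room for this slack, and the slack
    makes the q-th powers of the dilates summable when the pointwise bound is integrated. *)

Inductive mexpr :=
  MVar of nat | MZero | MAdd of mexpr & mexpr | MOpp of mexpr
| MScale of R & mexpr.

Fixpoint meval (vs : seq V) e : V :=
  match e with
  | MVar i => nth 0 vs i | MZero => 0 | MAdd a b => meval vs a + meval vs b
  | MOpp a => - meval vs a | MScale c a => c *: meval vs a
  end.

Fixpoint mcoef (i : nat) e : R :=
  match e with
  | MVar j => if eqn j i then 1 else 0 | MZero => 0
  | MAdd a b => mcoef i a + mcoef i b
  | MOpp a => - mcoef i a | MScale c a => c * mcoef i a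
  end.

(** A nested conjunction in [Prop], so that [cbn] and [split] leave one scalar identity per vector
    for [ring]. *)
Fixpoint mcheck (n : nat) e1 e2 : Prop :=
  if n is n'.+1 then mcoef n' e1 = mcoef n' e2 /\ mcheck n' e1 e2 else True.

Fixpoint mbound n e : bool :=
  match e with
  | MVar j => (j < n)%N | MZero => true | MAdd a b => mbound n a && mbound n b
  | MOpp a => mbound n a | MScale c a => mbound n a
  end.

Lemma mevalE vs e : mbound (size vs) e ->
  meval vs e = \sum_(i < size vs) mcoef i e *: vs`_i.
Proof.
elim: e => /= [j jn||a IHa b IHb /andP[/IHa -> /IHb ->]|a IHa /IHa ->|c a IHa /IHa ->].
- rewrite (bigD1 (Ordinal jn)) //= eqnE eqxx scale1r big1 ?addr0 // => i ij.
  by rewrite eq_sym ifN ?scale0r.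
- by move=> _; rewrite big1 // => i _; rewrite scale0r.
- by rewrite -big_split; apply: eq_bigr => i _; rewrite scalerDl.
- by rewrite -sumrN; apply: eq_bigr => i _; rewrite scaleNr.
- by rewrite scaler_sumr; apply: eq_bigr => i _; rewrite scalerA.
Qed.

Lemma meval_eq vs e1 e2 : mbound (size vs) e1 && mbound (size vs) e2 ->
  mcheck (size vs) e1 e2 -> meval vs e1 = meval vs e2.
Proof.
move=> /andP[b1 b2] chk; rewrite !mevalE //; apply: eq_bigr => i _.
congr (_ *: _); elim: (size vs) (i : nat) (ltn_ord i) chk => // n IHn j.
by rewrite ltnS leq_eqVlt => /predU1P[->|jn] /= [e12 /IHn] //; apply.
Qed.

End LmodReflection.

Ltac mod_index a l :=
  lazymatch l with
  | a :: _ => constr:(0%N)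
  | _ :: ?l' => let n := mod_index a l' in constr:(S n)
  end.

Ltac mod_add a l :=
  lazymatch l with
  | context [a :: _] => l
  | _ => constr:(a :: l)
  end.

Ltac mod_atoms t l :=
  lazymatch t with
  | ?a + ?b => let l' := mod_atoms a l in mod_atoms b l'
  | - ?a => mod_atoms a l
  | ?c *: ?a => mod_atoms a l
  | 0 => l
  | ?a => mod_add a l
  end.

Ltac mod_reify R t l :=
  lazymatch t with
  | ?a + ?b => let a' := mod_reify R a l in let b' := mod_reify R b l in
               constr:(MAdd a' b')
  | - ?a => let a' := mod_reify R a l in constr:(MOpp a')
  | ?c *: ?a => let a' := mod_reify R a l in constr:(MScale c a')
  | 0 => constr:(MZero R)
  | ?a => let n := mod_index a l in constr:(MVar R n)
  end.

(* Reduces an identity between linear combinations to the identities between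
   the coefficients of each vector. *)
Ltac lmodule R :=
  lazymatch goal with
  | |- @eq ?V ?a ?b =>
    let l := mod_atoms a (@nil V) in
    let l := mod_atoms b l in
    let e1 := mod_reify R a l in
    let e2 := mod_reify R b l in
    apply: (@meval_eq R _ l e1 e2);
    [by [] | cbn [mcheck mcoef size eqn]; repeat split; try ring]
  end.

(** * Generators of one-parameter isometry groups *)

Section IsometricGroup.
Context (R : realType) (E : completeNormedModType R).

Record isogroup (U : R -> E -> E) : Prop := Isogroup {
  isogroupA : forall s t x, U (s + t) x = U s (U t x);
  isogroup0 : forall x, U 0 x = x;
  isogroupD : forall s x y, U s (x + y) = U s x + U s y;
  isogroupZ : forall s c x, U s (c *: x) = c *: U s x;
  isogroup_le : forall s x, `|U s x| <= `|x|;
  isogroup_cvg : forall x (e : R), 0 < e ->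
    exists2 d : R, 0 < d & forall s, `|s| < d -> `|U s x - x| <= e }.

Context (U : R -> E -> E) (hU : isogroup U).

Lemma isogroupB s x y : U s (x - y) = U s x - U s y.
Proof.
by rewrite -[- y]scaleN1r (isogroupD hU) (isogroupZ hU) scaleN1r.
Qed.

(** Both [U s] and its inverse [U (- s)] are contractions. *)
Lemma isogroup_norm s x : `|U s x| = `|x|.
Proof.
apply/eqP; rewrite eq_le (isogroup_le hU) /=.
by rewrite -{1}(isogroup0 hU x) -(addNr s) (isogroupA hU) (isogroup_le hU).
Qed.

(** Multiplying the difference quotient by [h] gives a two-sided first-order estimate that also
    makes sense at [h = 0]. *)
Lemma gen_graphP f g : gen_graph U f g <->
  forall e : R, 0 < e -> exists2 d : R, 0 < d &
    forall h, `|h| < d -> `|U h f - f - h *: g| <= e * `|h|.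
Proof.
split.
  move=> /cvgrPdist_le H e e0; have /= := H e e0.
  rewrite /prop_near1 /= => -[d /= d0 Hd]; exists d => // h hd.
  have [->|h0] := eqVneq h 0.
    by rewrite (isogroup0 hU) subrr scale0r subr0 !normr0 mulr0.
  have := Hd h; rewrite /= sub0r normrN => /(_ hd h0).
  rewrite distrC -(@ler_pM2r _ `|h|) ?normr_gt0 // mulrC -normrZ scalerBr.
  by rewrite scalerA divff // scale1r.
move=> H; apply/cvgrPdist_le => e e0; have [d d0 Hd] := H e e0.
rewrite /prop_near1 /=; exists d => //= h; rewrite /= sub0r normrN => hd h0.
have := Hd h hd; rewrite -[e * _]mulrC -ler_pdivrMl ?normr_gt0 //.
by rewrite -normfV -normrZ scalerBr scalerA mulVf // scale1r distrC.
Qed.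

Lemma gen_graph_uniq f g g' : gen_graph U f g -> gen_graph U f g' -> g = g'.
Proof. by move=> H H'; apply: (cvg_unique _ H H'). Qed.

Lemma gen_graphD f g f' g' : gen_graph U f g -> gen_graph U f' g' ->
  gen_graph U (f + f') (g + g').
Proof.
move=> H H'; rewrite /gen_graph.
have -> : (fun t : R => t^-1 *: (U t (f + f') - (f + f'))) =
   (fun t : R => t^-1 *: (U t f - f)) \+ (fun t : R => t^-1 *: (U t f' - f')).
  apply/funext => t /=; rewrite (isogroupD hU); lmodule R.
exact: cvgD.
Qed.

Lemma gen_graphZ c f g : gen_graph U f g -> gen_graph U (c *: f) (c *: g).
Proof.
move=> H; rewrite /gen_graph.
have -> : (fun t : R => t^-1 *: (U t (c *: f) - c *: f)) =
   (fun t : R => c *: (t^-1 *: (U t f - f))).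
  apply/funext => t /=; rewrite (isogroupZ hU); lmodule R.
exact: cvgZr.
Qed.

Lemma gen_graphB f g f' g' : gen_graph U f g -> gen_graph U f' g' ->
  gen_graph U (f - f') (g - g').
Proof.
move=> H /(gen_graphZ (c := -1)) H'.
by rewrite -[- f']scaleN1r -[- g']scaleN1r; exact: gen_graphD.
Qed.

Lemma gen_graph0 : gen_graph U 0 0.
Proof.
apply/gen_graphP => e e0; exists 1 => // h _.
rewrite -(scale0r 0) (isogroupZ hU) !scale0r scaler0 !subr0 normr0.
by rewrite mulr_ge0 // ltW.
Qed.

(** Telescoping over [n] steps of length [d]: the step starting at kd contributes the image under
    U(kd) of the one-step remainder, plus d (U(kd) g - g). *)
Lemma gen_graph_iter (n : nat) (d e : R) f g : 0 <= d ->
  (forall s, 0 <= s <= n%:R * d -> `|U s g - g| <= e) ->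
  `|U (n%:R * d) f - f - (n%:R * d) *: g|
    <= n%:R * (`|U d f - f - d *: g| + d * e).
Proof.
move=> d0; elim: n => [|n IHn] H.
  by rewrite !mul0r (isogroup0 hU) subrr scale0r subr0 normr0.
set x := U d f - f - d *: g.
have -> : U (n.+1%:R * d) f - f - (n.+1%:R * d) *: g =
   (U (n%:R * d) x + d *: (U (n%:R * d) g - g)) +
   (U (n%:R * d) f - f - (n%:R * d) *: g).
  rewrite -natr1 mulrDl mul1r (isogroupA hU) /x !isogroupB (isogroupZ hU).
  lmodule R.
rewrite -natr1 mulrDl addrC mul1r (le_trans (ler_normD _ _)) // lerD //.
  apply: IHn => s /andP[s0 sn]; apply: H; rewrite s0 (le_trans sn) //.
  by rewrite ler_wpM2r // ler_nat.
rewrite (le_trans (ler_normD _ _)) // isogroup_norm lerD // normrZ ger0_norm //.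
rewrite ler_wpM2l // H // mulr_ge0 //= ler_wpM2r // ler_nat //.
Qed.

(* A description of the generator without division and without a limit:
   it passes to limits of the pair (f, g). *)
Lemma gen_graph_boundP f g : gen_graph U f g <->
  forall h e, 0 <= h -> (forall s, 0 <= s <= h -> `|U s g - g| <= e) ->
    `|U h f - f - h *: g| <= h * e.
Proof.
split=> [/gen_graphP H h e h0 He|H].
  apply/ler_addgt0Pr => e' e'0.
  have h1 : 0 < h + 1 by lra.
  have [d d0 Hd] := H _ (divr_gt0 e'0 h1).
  (* The step h/n is below [d], so each step has remainder at most e'/(h+1) times h/n, and the [n]
     remainders add up to at most e'. *)
  pose n := (Num.truncn (h / d)).+1.
  have n0 : 0 < n%:R :> R by rewrite ltr0n.
  have hn : h = n%:R * (h / n%:R) by field; rewrite gt_eqF.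
  have hnd : `|h / n%:R| < d.
    rewrite ger0_norm ?divr_ge0 // ?ltW // ltr_pdivrMr // mulrC -ltr_pdivrMr //.
    exact: truncnS_gt.
  rewrite {1 2}hn; apply: le_trans (gen_graph_iter (e := e) _ _ _) _.
  - by rewrite divr_ge0 // ltW.
  - by rewrite -hn.
  rewrite mulrDr [n%:R * (h / _ * e)]mulrA -hn addrC lerD2l.
  apply: le_trans (ler_wpM2l (ltW n0) (Hd _ hnd)) _.
  have hn0 : 0 <= h / n%:R by rewrite divr_ge0 // ltW.
  rewrite (ger0_norm hn0) mulrCA -hn -mulrA ler_piMr ?(ltW e'0) //.
  by rewrite mulrC ler_pdivrMr //; lra.
apply/gen_graphP => e e0.
have e2 : 0 < e / 2 by lra.
have [d d0 Hd] := isogroup_cvg hU g e2; exists d => // h hd.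
have pos k : 0 <= k -> `|k| < d -> `|U k f - f - k *: g| <= k * (e / 2).
  move=> k0 kd; apply: H => // s /andP[s0 sk]; apply: Hd.
  by rewrite ger0_norm // (le_lt_trans sk) // -[k]ger0_norm.
have [h0|h0] := leP 0 h.
  rewrite (le_trans (pos _ h0 hd)) // ger0_norm // mulrC ler_wpM2r //; lra.
(* Negative times are carried to positive ones by the isometry [U (- h)]; the price is the
   oscillation of [g] over time [- h]. *)
rewrite -(isogroup_norm (- h)) !isogroupB (isogroupZ hU).
rewrite -(isogroupA hU) addNr (isogroup0 hU).
have -> : f - U (- h) f - h *: U (- h) g =
  - (U (- h) f - f - (- h) *: g) + (- h) *: (U (- h) g - g).
  lmodule R.
rewrite (le_trans (ler_normD _ _)) // normrN normrZ normrN.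
have Nh0 : 0 <= - h by lra.
have := pos _ Nh0; rewrite normrN => /(_ hd) {}pos.
have := Hd (- h); rewrite normrN => /(_ hd) {}Hd.
have := ler_wpM2l (normr_ge0 h) Hd.
rewrite ltr0_norm // in pos *; lra.
Qed.

(** The 3 is one |g| for the linear term and the crude bound 2|g| for the oscillation of the orbit
    of [g]. *)
Lemma gen_graph_lip f g h : gen_graph U f g -> 0 <= h ->
  `|U h f - f| <= 3 * h * `|g|.
Proof.
move=> /gen_graph_boundP H h0.
have -> : U h f - f = (U h f - f - h *: g) + h *: g by lmodule R.
rewrite (le_trans (ler_normD _ _)) //.
rewrite normrZ (ger0_norm h0).
suff : `|U h f - f - h *: g| <= h * (2 * `|g|) by lra.
apply: (H _ _ h0) => s _.
by rewrite (le_trans (ler_normB _ _)) // isogroup_norm; lra.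
Qed.

Lemma gen_graph_closed (f_ g_ : nat -> E) f g :
  f_ @ \oo --> f -> g_ @ \oo --> g -> (forall n, gen_graph U (f_ n) (g_ n)) ->
  gen_graph U f g.
Proof.
move=> cf cg H; apply/gen_graph_boundP => h e h0 He.
apply/ler_addgt0Pr => e' e'0.
(* Replacing [f] by [f_ n] costs 2 such errors, replacing [g] costs [h] in the linear term and 2h in
   the oscillation. *)
have e1 : 0 < e' / (2 + 3 * h) by apply: divr_gt0 => //; lra.
near \oo => n.
have Hf : `|f - f_ n| <= e' / (2 + 3 * h) by near: n; move/cvgrPdist_le: cf; exact.
have Hg : `|g - g_ n| <= e' / (2 + 3 * h) by near: n; move/cvgrPdist_le: cg; exact.
have /gen_graph_boundP := H n => /(_ h (e + 2 * (e' / (2 + 3 * h))) h0) Hn.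
have -> : U h f - f - h *: g = (U h (f_ n) - f_ n - h *: g_ n) +
    (U h (f - f_ n) - (f - f_ n) - h *: (g - g_ n)).
  rewrite isogroupB; lmodule R.
rewrite (le_trans (ler_normD _ _)) //.
have {}Hn : `|U h (f_ n) - f_ n - h *: g_ n| <=
    h * (e + 2 * (e' / (2 + 3 * h))).
  apply: Hn => s hs.
  have -> : U s (g_ n) - g_ n = (U s g - g) - (U s (g - g_ n) - (g - g_ n)).
    rewrite isogroupB; lmodule R.
  rewrite (le_trans (ler_normB _ _)) // lerD //; first exact: He.
  by rewrite (le_trans (ler_normB _ _)) // isogroup_norm; lra.
have H2 : `|U h (f - f_ n) - (f - f_ n) - h *: (g - g_ n)| <=
    2 * (e' / (2 + 3 * h)) + h * (e' / (2 + 3 * h)).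
  rewrite (le_trans (ler_normB _ _)) // normrZ (ger0_norm h0) lerD //.
    by rewrite (le_trans (ler_normB _ _)) // isogroup_norm; lra.
  by rewrite ler_wpM2l.
apply: le_trans (lerD Hn H2) _.
have -> : h * (e + 2 * (e' / (2 + 3 * h))) +
  (2 * (e' / (2 + 3 * h)) + h * (e' / (2 + 3 * h))) = h * e + e'.
  by field; rewrite gt_eqF //; lra.
by [].
Unshelve. all: by end_near. Qed.

(** Taylor's formula solved for the first derivative: tg is U(t)f - f minus a remainder, and
    [gen_graph_lip] for [g] bounds the oscillation in this remainder by 3t|g2|. *)
Lemma gen_graph_landau f g g2 t : gen_graph U f g -> gen_graph U g g2 -> 0 < t ->
  `|g| <= 2 * t^-1 * `|f| + 3 * t * `|g2|.
Proof.
move=> /gen_graph_boundP Hf Hg t0.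
have H : `|U t f - f - t *: g| <= t * (3 * t * `|g2|).
  apply: Hf; rewrite ?ltW // => s /andP[s0 st].
  rewrite (le_trans (gen_graph_lip Hg s0)) // ler_wpM2r //; lra.
rewrite -(ler_pM2l t0) -{1}(ger0_norm (ltW t0)) -normrZ.
have -> : t *: g = (U t f - f) - (U t f - f - t *: g) by lmodule R.
rewrite (le_trans (ler_normB _ _)) // mulrDr lerD //.
have -> : t * (2 * t^-1 * `|f|) = 2 * `|f| by field; rewrite gt_eqF.
by rewrite (le_trans (ler_normB _ _)) // isogroup_norm; lra.
Qed.

End IsometricGroup.

(** * Averages of continuous vector-valued functions *)

Section DyadicMean.
Context (R : realType) (E : completeNormedModType R).
Implicit Types (phi psi : R -> E).

Definition left_half phi (s : R) := phi (2^-1 * s).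
Definition right_half phi (s : R) := phi (2^-1 * s + 2^-1).

(** The left-endpoint Riemann sum over 2^n equal subintervals of [0, 1], organised by halving so
    that its properties follow by induction on [n] for all [phi] at once. *)
Fixpoint dyadic_mean n phi : E :=
  if n is n'.+1 then
    2^-1 *: (dyadic_mean n' (left_half phi) + dyadic_mean n' (right_half phi))
  else phi 0.

Lemma dyadic_meanD n phi psi :
  dyadic_mean n (phi \+ psi) = dyadic_mean n phi + dyadic_mean n psi.
Proof.
elim: n phi psi => //= n IHn phi psi.
rewrite -[left_half (_ \+ _)]/(left_half phi \+ left_half psi) IHn.
rewrite -[right_half (_ \+ _)]/(right_half phi \+ right_half psi) IHn.
lmodule R.
Qed.

Lemma dyadic_meanZ n c phi :
  dyadic_mean n (c \*: phi) = c *: dyadic_mean n phi.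
Proof.
elim: n phi => //= n IHn phi.
rewrite -[left_half (_ \*: _)]/(c \*: left_half phi) IHn.
rewrite -[right_half (_ \*: _)]/(c \*: right_half phi) IHn.
lmodule R.
Qed.

Lemma half_eq (x : E) : 2^-1 *: (x + x) = x.
Proof. by rewrite -[RHS]scale1r; lmodule R; field. Qed.

Lemma dyadic_mean_cst n v : dyadic_mean n (cst v) = v.
Proof. by elim: n => //= n; rewrite /left_half /right_half /= => ->; exact: half_eq. Qed.

Lemma dyadic_mean_le n phi v M : (forall s, 0 <= s <= 1 -> `|phi s - v| <= M) ->
  `|dyadic_mean n phi - v| <= M.
Proof.
elim: n phi => /= [phi H|n IHn phi H]; first by apply: H; rewrite lexx ler01.
rewrite -{1}(half_eq v) -scalerBr normrZ ger0_norm ?invr_ge0 //.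
have -> : forall x y : E, x + y - (v + v) = (x - v) + (y - v).
  by move=> x y; lmodule R.
rewrite ler_pdivrMl // mulr2n mulrDl mul1r (le_trans (ler_normD _ _)) // lerD //.
  by apply: IHn => s hs; apply: H; lra.
by apply: IHn => s hs; apply: H; lra.
Qed.

(** The halves of [phi] are stretched by 2, so a modulus at distance 2^-n becomes one at distance
    2^-(n-1); at n = 0 every value on [0, 1] is within [e] of [phi 0]. *)
Lemma dyadic_mean_osc n m phi e :
  (forall x y, 0 <= x <= 1 -> 0 <= y <= 1 -> `|x - y| <= 2^-1 ^+ n ->
     `|phi x - phi y| <= e) ->
  `|dyadic_mean (n + m) phi - dyadic_mean n phi| <= e.
Proof.
elim: n phi => /= [phi H|n IHn phi H].
  apply: dyadic_mean_le => s hs; apply: H; rewrite ?lexx ?ler01 //.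
  by rewrite subr0 expr0 ger0_norm; lra.
rewrite -scalerBr normrZ ger0_norm ?invr_ge0 //.
have -> : forall x y z w : E, x + y - (z + w) = (x - z) + (y - w).
  by move=> x y z w; lmodule R.
rewrite ler_pdivrMl // mulr2n mulrDl mul1r (le_trans (ler_normD _ _)) // lerD //.
  apply: IHn => x y hx hy hxy; apply: H; [lra|lra|].
  by rewrite -mulrBr normrM ger0_norm ?invr_ge0 // exprS ler_pM2l ?invr_gt0.
apply: IHn => x y hx hy hxy; apply: H; [lra|lra|].
rewrite opprD addrACA subrr addr0.
by rewrite -mulrBr normrM ger0_norm ?invr_ge0 // exprS ler_pM2l ?invr_gt0.
Qed.

(** Heine's theorem, from compactness of [0, 1] in its near-covering form. *)
Lemma continuous_uniform_itv01 phi : continuous phi -> forall e : R, 0 < e ->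
  exists2 d : R, 0 < d & forall x y, 0 <= x <= 1 -> `|x - y| < d ->
    `|phi x - phi y| <= e.
Proof.
move=> cphi e e0.
have /compact_near_coveringP cpt := @segment_compact R 0 1.
have := cpt _ (0 : R)^'+ (fun d x => forall y, `|x - y| < d -> `|phi x - phi y| <= e) _.
case.
  move=> x _.
  have e2 : 0 < e / 2 by lra.
  have /cvgrPdist_le /(_ _ e2) := cphi x.
  rewrite -filter_from_ballE => -[d /= d0 Hd].
  have d2 : 0 < d / 2 by lra.
  near=> x' t => y /= xy.
  have xx' : `|x - x'| < d / 2 by near: x'; apply: cvgr_dist_lt.
  have td : t < d / 2 by near: t; apply: nbhs_right_lt.
  have -> : phi x' - phi y = (phi x - phi y) - (phi x - phi x') by lmodule R.
  rewrite (le_trans (ler_normB _ _)) // [e]splitr lerD //.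
    apply: Hd; rewrite /ball /=.
    have -> : x - y = (x - x') + (x' - y) by ring.
    rewrite (le_lt_trans (ler_normD _ _)) //; lra.
  by apply: Hd; rewrite /ball /=; lra.
move=> d /= d0 Hd; exists (d / 2); first by lra.
move=> x y hx hxy; apply: (Hd (d / 2)) => //=.
  by rewrite sub0r normrN ger0_norm; lra.
by lra.
Unshelve. all: by end_near. Qed.

(** For continuous [phi], this is the integral over [0, 1]. *)
Definition mean phi : E := lim (dyadic_mean n phi @[n --> \oo]).

Lemma near_half_lt (d : R) : 0 < d -> \forall n \near \oo, 2^-1 ^+ n < d :> R.
Proof.
move=> d0; have h1 : `|2^-1 : R| < 1 by rewrite ger0_norm ?invr_ge0 // invf_lt1 // ltr1n.
have /cvgrPdist_lt /(_ d d0) := cvg_expr h1.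
by apply: filterS => n /=; rewrite sub0r normrN ger0_norm.
Qed.

Lemma cvg_mean phi : continuous phi -> dyadic_mean n phi @[n --> \oo] --> mean phi.
Proof.
move=> cphi; apply/cauchy_cvgP/cauchy_exP => e e0.
have e2 : 0 < e / 2 by lra.
have [d d0 Hd] := continuous_uniform_itv01 cphi e2.
have [n _ /(_ n) /(_ (leqnn n)) nd] := near_half_lt d0.
exists (dyadic_mean n phi); exists n => // m /= nm.
rewrite -ball_normE /= -(subnKC nm) distrC; apply: (@le_lt_trans _ _ (e / 2)).
  apply: dyadic_mean_osc => x y hx hy xy.
  by apply: Hd => //; apply: le_lt_trans nd.
by lra.
Qed.

Lemma mean_cst v : mean (cst v) = v.
Proof.
rewrite /mean; under eq_fun do rewrite dyadic_mean_cst.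
exact: lim_cst.
Qed.

Lemma cvg_norm_le (u : nat -> E) l (M : R) : u @ \oo --> l ->
  (forall n, `|u n| <= M) -> `|l| <= M.
Proof.
move=> ul uM; apply/ler_addgt0Pr => e e0; near \oo => n.
have : `|l - u n| <= e by near: n; move/cvgrPdist_le: ul; exact.
move=> H; have -> : l = u n + (l - u n) by lmodule R.
by rewrite (le_trans (ler_normD _ _)) // lerD.
Unshelve. all: by end_near. Qed.

Lemma mean_le phi v M : continuous phi ->
  (forall s, 0 <= s <= 1 -> `|phi s - v| <= M) -> `|mean phi - v| <= M.
Proof.
move=> cphi H; apply: (@cvg_norm_le (fun n => dyadic_mean n phi - v)).
  by apply: cvgB; [exact: cvg_mean | exact: cvg_cst].
by move=> n; exact: dyadic_mean_le.
Qed.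

Lemma meanD phi psi : continuous phi -> continuous psi ->
  mean (phi \+ psi) = mean phi + mean psi.
Proof.
move=> cphi cpsi; apply: cvg_lim => //.
under eq_fun do rewrite dyadic_meanD.
by apply: cvgD; exact: cvg_mean.
Qed.

Lemma meanZ c phi : continuous phi -> mean (c \*: phi) = c *: mean phi.
Proof.
move=> cphi; apply: cvg_lim => //.
under eq_fun do rewrite dyadic_meanZ.
by apply: cvgZr; exact: cvg_mean.
Qed.

(** * Generators applied to averages *)

Section MeanGenerator.
Context (U : R -> E -> E) (hU : isogroup U).

Lemma gen_graph_dyadic_mean n phi psi :
  (forall s, 0 <= s <= 1 -> gen_graph U (phi s) (psi s)) ->
  gen_graph U (dyadic_mean n phi) (dyadic_mean n psi).
Proof.
elim: n phi psi => /= [phi psi H|n IHn phi psi H].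
  by apply: H; rewrite lexx ler01.
apply: (gen_graphZ hU); apply: (gen_graphD hU); apply: IHn => s hs; apply: H; lra.
Qed.

Lemma gen_graph_mean phi psi : continuous phi -> continuous psi ->
  (forall s, 0 <= s <= 1 -> gen_graph U (phi s) (psi s)) ->
  gen_graph U (mean phi) (mean psi).
Proof.
move=> cphi cpsi H; apply: (gen_graph_closed hU (cvg_mean cphi) (cvg_mean cpsi)).
by move=> n; exact: gen_graph_dyadic_mean.
Qed.

Lemma isogroup_orbit_continuous (t : R) f : continuous (fun s : R => U (s * t) f).
Proof.
move=> s; apply/cvgrPdist_le => e e0.
have [d d0 Hd] := isogroup_cvg hU f e0.
have : (fun x : R => x * t) @ (s : R) --> s * t.
  by apply: cvgM; [exact: cvg_id | exact: cvg_cst].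
move/cvgrPdist_lt => /(_ d d0); apply: filterS => x /=.
move=> H; rewrite -{1}[s * t](subrK (x * t)) (addrC (s * t - x * t)).
rewrite (isogroupA hU).
by rewrite -(isogroupB hU) (isogroup_norm hU) Hd.
Qed.

(** A shift by one mesh width moves each node of the Riemann sum to the next, so the difference
    telescopes exactly, already before the limit. *)
Lemma dyadic_mean_orbit n t f :
  U (2^-1 ^+ n * t) (dyadic_mean n (fun s => U (s * t) f)) -
    dyadic_mean n (fun s => U (s * t) f) = 2^-1 ^+ n *: (U t f - f).
Proof.
elim: n t f => [|n IHn] t f.
  by rewrite expr0 /= mul0r mul1r scale1r (isogroup0 hU).
have lh : left_half (fun s => U (s * t) f) = (fun s => U (s * (2^-1 * t)) f).
  by apply/funext => s; rewrite /left_half -mulrA mulrCA mulrA.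
have rh : right_half (fun s => U (s * t) f) =
    (fun s => U (s * (2^-1 * t)) (U (2^-1 * t) f)).
  by apply/funext => s; rewrite /right_half -(isogroupA hU); congr (U _ f); ring.
rewrite /= lh rh exprSr -mulrA (isogroupZ hU) (isogroupD hU).
set X := dyadic_mean n _; set Y := dyadic_mean n _.
have IX := IHn (2^-1 * t) f; have IY := IHn (2^-1 * t) (U (2^-1 * t) f).
rewrite -/X in IX; rewrite -/Y -(isogroupA hU) -mulrDl in IY.
have h2 : 2^-1 + 2^-1 = 1 :> R by field.
rewrite h2 mul1r in IY.
transitivity (2^-1 *: ((U (2^-1 ^+ n * (2^-1 * t)) X - X) +
   (U (2^-1 ^+ n * (2^-1 * t)) Y - Y))); first by lmodule R.
by rewrite IX IY; lmodule R.
Qed.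

(** The fundamental theorem of calculus for an orbit. At multiples of the mesh width
    [gen_graph_iter] applies to the Riemann sum with zero one-step remainder. *)
Lemma gen_graph_mean_orbit t f : 0 < t ->
  gen_graph U (mean (fun s => U (s * t) f)) (t^-1 *: (U t f - f)).
Proof.
move=> t0; apply/(gen_graph_boundP hU) => h e h0 He.
set v := t^-1 *: _ in He *; set M := mean _.
have e0 : 0 <= e by apply: le_trans (He 0 _); rewrite ?normr_ge0 ?lexx ?h0.
apply/ler_addgt0Pr => e' e'0.
have e8 : 0 < e' / 8 by lra.
have [d d0 Hd] := isogroup_cvg hU M e8.
have ev : 0 < e' / 8 / (`|v| + 1) by apply: divr_gt0 => //; have := normr_ge0 v; lra.
(* The mesh width is to be so small that over one mesh both the orbit of [M] and the linear term in
   [v] move by at most e'/8. *)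
have dt : 0 < Num.min d (e' / 8 / (`|v| + 1)) / t by rewrite divr_gt0 // lt_min d0.
near \oo => n.
have : `|M - dyadic_mean n (fun s => U (s * t) f)| <= e' / 8.
  near: n; have /cvgrPdist_le := cvg_mean (@isogroup_orbit_continuous t f); exact.
set Mn := dyadic_mean n _ => HM.
have : 2^-1 ^+ n < Num.min d (e' / 8 / (`|v| + 1)) / t.
  by near: n; exact: near_half_lt.
rewrite ltr_pdivlMr // lt_min => /andP[dd dv].
set del := 2^-1 ^+ n * t in dd dv.
have del0 : 0 < del by rewrite mulr_gt0 // exprn_gt0 // invr_gt0.
(* [h] is rounded down to [m] whole meshes; the rest is shorter than [del]. *)
pose m := Num.truncn (h / del).
have /andP[mh hm] : m%:R <= h / del < m.+1%:R.
  by apply: truncn_itv; rewrite divr_ge0 // ltW.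
rewrite ler_pdivlMr // in mh; rewrite ltr_pdivrMr // -natr1 mulrDl mul1r in hm.
have Mnv : `|U del Mn - Mn - del *: v| = 0.
  rewrite dyadic_mean_orbit /v /del scalerA -mulrA divff ?gt_eqF // mulr1.
  by rewrite subrr normr0.
have X : `|U (m%:R * del) Mn - Mn - (m%:R * del) *: v| <= h * e.
  apply: le_trans (gen_graph_iter hU (e := e) _ _ _) _; first exact: ltW.
    by move=> s /andP[s0 sm]; apply: He; rewrite s0 (le_trans sm).
  by rewrite Mnv add0r mulrA ler_wpM2r.
have Y : `|U (h - m%:R * del) M - M| <= e' / 8.
  by apply: Hd; rewrite ger0_norm; lra.
have Z : `|(h - m%:R * del) *: v| <= e' / 8.
  rewrite normrZ ger0_norm; last by lra.
  rewrite ltr_pdivlMr in dv; last by have := normr_ge0 v; lra.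
  have : (h - m%:R * del) * `|v| <= del * `|v| by rewrite ler_wpM2r //; lra.
  lra.
have -> : U h M - M - h *: v = (U (m%:R * del) Mn - Mn - (m%:R * del) *: v) +
   (U h (M - Mn) - (M - Mn)) +
   U (m%:R * del) (U (h - m%:R * del) (Mn - M) - (Mn - M) +
     (U (h - m%:R * del) M - M)) - (h - m%:R * del) *: v.
  rewrite (isogroupD hU (m%:R * del)) !(isogroupB hU) -!(isogroupA hU).
  have -> : m%:R * del + (h - m%:R * del) = h by ring.
  lmodule R.
have A1 : `|U h (M - Mn) - (M - Mn)| <= e' / 4.
  by rewrite (le_trans (ler_normB _ _)) // (isogroup_norm hU); lra.
have A2 : `|U (h - m%:R * del) (Mn - M) - (Mn - M)| <= e' / 4.
  by rewrite (le_trans (ler_normB _ _)) // (isogroup_norm hU) [`|Mn - _|]distrC; lra.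
set W := U (h - m%:R * del) (Mn - M) - (Mn - M) in A2 *.
have A3 : `|U (m%:R * del) (W + (U (h - m%:R * del) M - M))| <= e' / 4 + e' / 8.
  by rewrite (isogroup_norm hU) (le_trans (ler_normD _ _)) // lerD.
rewrite (le_trans (ler_normB _ _)) //.
apply: le_trans (lerD (le_trans (ler_normD _ _) (lerD (le_trans (ler_normD _ _)
   (lerD X A1)) A3)) Z) _.
lra.
Unshelve. all: by end_near. Qed.

End MeanGenerator.
End DyadicMean.

(** * Generators of a representation of the ax+b group *)

Section AxbRep.
Context (R : realType) (E : completeNormedModType R) (T : R -> R -> E -> E).
Hypothesis hT : is_axb_contraction_rep T.

Lemma axbD a b x y : 0 < a -> T a b (x + y) = T a b x + T a b y.
Proof. by case: hT => -[H _ _ _] _ a0; apply: H. Qed.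

Lemma axbZ a b c x : 0 < a -> T a b (c *: x) = c *: T a b x.
Proof. by case: hT => -[_ H _ _] _ a0; apply: H. Qed.

Lemma axb1 x : T 1 0 x = x.
Proof. by case: hT => -[_ _ H _] _. Qed.

Lemma axbM a1 b1 a2 b2 x : 0 < a1 -> 0 < a2 ->
  T a1 b1 (T a2 b2 x) = T (a1 * a2) (a1 * b2 + b1) x.
Proof. by case: hT => -[_ _ _ H] _ a10 a20; apply: H. Qed.

Lemma axb_le a b x : 0 < a -> `|T a b x| <= `|x|.
Proof. by case: hT => _ [H _] a0; apply: H. Qed.

Lemma axbN a b x : 0 < a -> T a b (- x) = - T a b x.
Proof. by move=> a0; rewrite -scaleN1r axbZ // scaleN1r. Qed.

Lemma axbB a b x y : 0 < a -> T a b (x - y) = T a b x - T a b y.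
Proof. by move=> a0; rewrite axbD // axbN. Qed.

(** The half-plane a > 0 is open, so continuity within it is continuity at each of its points and
    composes with a curve. *)
Lemma axb_curve_continuous (a b : R -> R) x : continuous a -> continuous b ->
  (forall s, 0 < a s) -> continuous (fun s : R => T (a s) (b s) x).
Proof.
move=> ca cb a0 s; case: hT => _ [_ /(_ x)].
rewrite continuous_open_subspace; last first.
  rewrite (_ : [set g : R * R | _] = fst @^-1` [set x : R | 0 < x]) //.
  by apply: open_comp; [move=> ? _; exact: cvg_fst | exact: open_gt].
move=> /(_ (a s, b s)); rewrite inE /= => /(_ (a0 s)) H.
by apply: (cvg_comp2 (ca s) (cb s) (h := fun x1 x2 => T x1 x2 x)).
Qed.

Lemma T12_isogroup j : isogroup (T12 T j).
Proof.
have cvg0 (a b : R -> R) : continuous a -> continuous b ->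
    (forall s, 0 < a s) -> a 0 = 1 -> b 0 = 0 -> forall x (e : R), 0 < e ->
    exists2 d : R, 0 < d & forall s, `|s| < d -> `|T (a s) (b s) x - x| <= e.
  move=> ca cb a0 a1 b0 x e e0.
  have /cvgrPdist_le /(_ e e0) := @axb_curve_continuous a b x ca cb a0 0.
  rewrite a1 b0 axb1 => -[d /= d0 Hd]; exists d => // s sd.
  by rewrite distrC; apply: Hd; rewrite /= sub0r normrN.
case: j; split; rewrite /T12.
- by move=> s t x; rewrite axbM ?expR_gt0 // mulr0 addr0 expRD.
- by move=> x; rewrite expR0 axb1.
- by move=> s x y; rewrite axbD // expR_gt0.
- by move=> s c x; rewrite axbZ // expR_gt0.
- by move=> s x; rewrite axb_le // expR_gt0.
- apply: (cvg0 expR (fun=> 0)) => //; first exact: continuous_expR.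
  + by move=> s; exact: cvg_cst.
  + by move=> s; exact: expR_gt0.
  + exact: expR0.
- by move=> s t x; rewrite axbM ?ltr01 // !mul1r addrC.
- by move=> x; rewrite axb1.
- by move=> s x y; rewrite axbD.
- by move=> s c x; rewrite axbZ.
- by move=> s x; rewrite axb_le.
- by apply: (cvg0 (fun=> 1) (fun s => s)) => // s; [exact: cvg_cst | exact: cvg_id].
Qed.

Notation A1 := (gen_graph (T12 T true)).
Notation A2 := (gen_graph (T12 T false)).

(** From the group identity (1, h)(a, b) = (a, b)(1, h/a). *)
Lemma gen_graph2_axb a b f g : 0 < a -> A2 f g -> A2 (T a b f) (a^-1 *: T a b g).
Proof.
move=> a0 /(gen_graphP (T12_isogroup false)) H.
apply/(gen_graphP (T12_isogroup false)) => e e0.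
have [d d0 Hd] := H _ (mulr_gt0 e0 a0); exists (d * a); first exact: mulr_gt0.
move=> h hd; rewrite /T12.
have -> : T 1 h (T a b f) = T a b (T 1 (h / a) f).
  by rewrite !axbM // mul1r mulr1; congr (T _ _ f); field; rewrite gt_eqF.
have -> : T a b (T 1 (h / a) f) - T a b f - h *: (a^-1 *: T a b g) =
    T a b (T 1 (h / a) f - f - (h / a) *: g).
  by rewrite !axbB // axbZ // scalerA.
have ha : `|h / a| = `|h| / a by rewrite normrM normfV (gtr0_norm a0).
rewrite (le_trans (axb_le _ _ a0)) // (le_trans (Hd _ _)) //.
  by rewrite ha ltr_pdivrMr.
have -> : e * a * `|h / a| = e * `|h| by rewrite ha; field; rewrite gt_eqF.
by [].
Qed.

(** From exp(-h) >= 1 - h one gets exp(h)(1 - h) <= 1, hence (exp(h) - 1 - h)(1 - h) <= h^2, and 1 -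
    h >= 1/2. *)
Lemma expR_sub1Dx_bound (h : R) : `|h| <= 2^-1 -> 0 <= expR h - 1 - h <= 2 * `|h| ^+ 2.
Proof.
move=> hh; have := expR_ge1Dx h; have := expR_ge1Dx (- h); rewrite expRN.
have := expR_gt0 h; have := ler_norm h; have := ler_norm (- h); rewrite normrN.
set x := expR h; move=> h1 h2 x0 Hx Hx'; apply/andP; split; first lra.
have h3 : 0 < 1 - h by lra.
have xh : x * (1 - h) <= 1.
  by have := ler_wpM2l (ltW x0) Hx; rewrite divff ?gt_eqF.
rewrite real_normK ?num_real // -(ler_pM2r h3).
have -> : (x - 1 - h) * (1 - h) = x * (1 - h) - 1 + h ^+ 2 by ring.
have h4 : 2^-1 <= 1 - h by lra.
have := ler_wpM2l (sqr_ge0 h) h4; lra.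
Qed.

(** From the group identity (e^h, 0)(a, b) = (a, b)(1, y)(e^h, 0) with y = (e^h - 1) b/a. As y = h
    b/a + O(h^2), the factor (1, y) contributes the term in A_2. *)
Lemma gen_graph1_axb a b f g1 g2 : 0 < a -> A1 f g1 -> A2 f g2 ->
  A1 (T a b f) (T a b g1 + (b / a) *: T a b g2).
Proof.
move=> a0 /(gen_graphP (T12_isogroup true)) H1 /(gen_graphP (T12_isogroup false)) H2.
apply/(gen_graphP (T12_isogroup true)) => e e0.
set c := b / a; have c0 := normr_ge0 c; have g20 := normr_ge0 g2.
have e4 : 0 < e / 4 by lra.
have e8 : 0 < e / (8 * (`|c| + 1)) by rewrite divr_gt0 //; lra.
have cg0 : 0 <= `|c| * `|g2| by rewrite mulr_ge0.
have e9 : 0 < e / (8 * (`|c| * `|g2| + 1)) by rewrite divr_gt0 //; lra.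
have [d1 d10 Hd1] := H1 _ e4.
have [d2 d20 Hd2] := isogroup_cvg (T12_isogroup false) g1 e4.
have [d3 d30 Hd3] := H2 _ e8.
pose d4 := Num.min d2 d3 / (2 * (`|c| + 1)).
have d40 : 0 < d4 by rewrite divr_gt0 ?lt_min ?d20 //; lra.
exists (Num.min (Num.min d1 2^-1) (Num.min d4 (e / (8 * (`|c| * `|g2| + 1))))).
  by rewrite !lt_min d10 d40 e9 invr_gt0 ltr0n.
move=> h; rewrite !lt_min => /andP[/andP[hd1 h2] /andP[hd4 he]].
set y := (expR h - 1) * c.
have /andP[eh0 eh] := expR_sub1Dx_bound (ltW h2).
have h0 := normr_ge0 h.
have hh : `|h| ^+ 2 <= 2^-1 * `|h| by rewrite expr2 ler_wpM2r // ltW.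
have yh : `|y| <= 2 * (`|c| * `|h|).
  rewrite /y normrM mulrC mulrCA ler_wpM2l //.
  have -> : expR h - 1 = (expR h - 1 - h) + h by ring.
  rewrite (le_trans (ler_normD _ _)) // (ger0_norm eh0); lra.
have yd : `|y| < Num.min d2 d3.
  rewrite ltr_pdivlMr in hd4; last lra.
  apply: le_lt_trans hd4; apply: le_trans yh _.
  have := mulr_ge0 c0 h0; lra.
move: yd; rewrite lt_min => /andP[yd2 yd3].
(* Four errors of at most e|h|/4 each: first order of T_1 at [f], continuity of T_2 at [g1], first
   order of T_2 at [f], and the quadratic difference of [y] and hc. *)
have -> : T12 T true h (T a b f) - T a b f - h *: (T a b g1 + c *: T a b g2) =
   T a b (T12 T false y (T12 T true h f - f - h *: g1) +
     h *: (T12 T false y g1 - g1) + (T12 T false y f - f - y *: g2) +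
     (y - h * c) *: g2).
  have -> : T12 T true h (T a b f) = T a b (T12 T false y (T12 T true h f)).
    rewrite /T12 !axbM ?expR_gt0 // ?ltr01 // ?mulr_gt0 ?expR_gt0 //.
    by congr (T _ _ f); rewrite /y /c; field; rewrite ?gt_eqF.
  have hS := T12_isogroup false.
  rewrite !(isogroupB hS) (isogroupZ hS) !(axbD, axbN, axbZ) //.
  lmodule R.
rewrite (le_trans (axb_le _ _ a0)) //.
have B1 : `|T12 T false y (T12 T true h f - f - h *: g1)| <= e / 4 * `|h|.
  by rewrite (isogroup_norm (T12_isogroup false)) Hd1.
have B2 : `|h *: (T12 T false y g1 - g1)| <= e / 4 * `|h|.
  by rewrite normrZ mulrC ler_wpM2r // Hd2.
have B3 : `|T12 T false y f - f - y *: g2| <= e / 4 * `|h|.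
  apply: le_trans (Hd3 _ yd3) _; rewrite -mulrA mulrAC.
  rewrite -mulrA ler_wpM2l ?(ltW e0) //.
  rewrite ler_pdivrMl; last lra.
  have := mulr_ge0 c0 h0; lra.
have B4 : `|(y - h * c) *: g2| <= e / 4 * `|h|.
  have -> : y - h * c = c * (expR h - 1 - h) by rewrite /y; ring.
  rewrite normrZ normrM (ger0_norm eh0).
  rewrite ltr_pdivlMr in he; last lra.
  have := ler_wpM2l cg0 eh.
  have := ler_wpM2r h0 (ltW he).
  have := mulr_ge0 h0 h0.
  rewrite expr2; nra.
apply: le_trans (le_trans (ler_normD _ _) (lerD (le_trans (ler_normD _ _)
  (lerD (le_trans (ler_normD _ _) (lerD B1 B2)) B3)) B4)) _.
lra.
Qed.

End AxbRep.

(** * The spaces of smooth vectors *)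

Section SmoothSpaces.
Context (R : realType) (E : completeNormedModType R) (T : R -> R -> E -> E).
Hypothesis hT : is_axb_contraction_rep T.

Notation A1 := (gen_graph (T12 T true)).
Notation A2 := (gen_graph (T12 T false)).
Notation N := (Er_norm T).

Lemma word_graph_uniq w f g g' : word_graph T w f g -> word_graph T w f g' -> g = g'.
Proof.
elim: w g g' => [g g' /= -> -> //|j w IHw g g' /= [h [wh jh]] [h' [wh' jh']]].
rewrite -(IHw _ _ wh wh') in jh'; exact: gen_graph_uniq jh jh'.
Qed.

(** [word_graph] peels off the generator applied last; induction on the order of smoothness needs
    the one applied first, at the end of the word. *)
Lemma word_graph_rcons w j f g : word_graph T (rcons w j) f g <->
  exists h, gen_graph (T12 T j) f h /\ word_graph T w h g.
Proof.
elim: w g => [|i w IHw] g /=.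
  split=> [[h [-> jg]]|[h [jh ->]]]; first by exists g.
  by exists f.
split=> [[h [/IHw[k [jk wh] ih]]]|[k [jk [h [wh ih]]]]].
  by exists k; split => //; exists h.
by exists h; split => //; apply/IHw; exists k.
Qed.

(** Both sides are [xget] of equal sets; this covers an undefined word, where both take the default
    value 0. *)
Lemma word_op_rcons w j f g : gen_graph (T12 T j) f g ->
  word_op T (rcons w j) f = word_op T w g.
Proof.
move=> jg; congr xget; apply/seteqP; split=> x /=.
  by move=> /word_graph_rcons[h [jh]]; rewrite (gen_graph_uniq jg jh).
by move=> wx; apply/word_graph_rcons; exists g.
Qed.

Lemma word_op_nil f : word_op T [::] f = f.
Proof.
by apply: (@word_graph_uniq [::] f) => //; apply: xgetPex; exists f.
Qed.

Lemma ErS k f : Er T k.+1 f <->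
  exists g1 g2, [/\ A1 f g1, A2 f g2, Er T k g1 & Er T k g2].
Proof.
split=> [H|[g1 [g2 [f1 f2 H1 H2]]] w].
  have [g1 /= [_ [-> f1]]] := H [:: true] isT.
  have [g2 /= [_ [-> f2]]] := H [:: false] isT.
  exists g1, g2; split=> // w wk.
    have [|g /word_graph_rcons[h [jh wh]]] := H (rcons w true).
      by rewrite size_rcons.
    by exists g; rewrite (gen_graph_uniq f1 jh).
  have [|g /word_graph_rcons[h [jh wh]]] := H (rcons w false).
    by rewrite size_rcons.
  by exists g; rewrite (gen_graph_uniq f2 jh).
case/lastP: w => [_|w [] ]; first by exists f.
  rewrite size_rcons => /H1[g wg]; exists g; apply/word_graph_rcons; by exists g1.
rewrite size_rcons => /H2[g wg]; exists g; apply/word_graph_rcons; by exists g2.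
Qed.

Lemma Er0 f : Er T 0 f.
Proof. by case=> // _; exists f. Qed.

Lemma Er_le k l f : (k <= l)%N -> Er T l f -> Er T k f.
Proof. by move=> kl H w wk; apply: H; apply: leq_trans kl. Qed.

Lemma big_tuple_rcons n (F : seq bool -> R) :
  \sum_(w : n.+1.-tuple bool) F (tval w) =
  \sum_(w : n.-tuple bool) (F (rcons (tval w) true) + F (rcons (tval w) false)).
Proof.
pose h (p : n.-tuple bool * bool) : n.+1.-tuple bool := [tuple of rcons p.1 p.2].
have injh : injective h.
  move=> [w1 b1] [w2 b2] /(congr1 (@tval _ _)) /= /rcons_inj[/val_inj -> ->] //.
have bijh : bijective h.
  by apply: inj_card_bij => //; rewrite card_prod !card_tuple card_bool expnSr.
rewrite (reindex h) /=; last exact: onW_bij.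
rewrite -(pair_bigA _ (fun (w : n.-tuple bool) b => F (rcons (tval w) b))) /=.
by apply: eq_bigr => w _; rewrite big_bool.
Qed.

Lemma Er_normE k f :
  N k f = \sum_(0 <= i < k.+1) \sum_(w : i.-tuple bool) `|word_op T (tval w) f|.
Proof.
rewrite /Er_norm [RHS]big_nat_recl // big_add1 /=; congr (_ + _).
rewrite (big_pred1 [tuple]) => [|w /=]; first by rewrite /= word_op_nil.
by rewrite tuple0; apply/esym/eqP.
Qed.

Lemma Er_norm0 f : N 0 f = `|f|.
Proof. by rewrite /Er_norm big_geq // addr0. Qed.

(** Nonempty words are sorted by the generator applied first. The later inductions on the order use
    this recursion and not the double sum. *)
Lemma Er_normS k f g1 g2 : A1 f g1 -> A2 f g2 ->
  N k.+1 f = `|f| + (N k g1 + N k g2).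
Proof.
move=> f1 f2; rewrite {1}/Er_norm big_add1 /=; congr (_ + _).
rewrite !Er_normE -big_split; apply: eq_bigr => i _.
rewrite (@big_tuple_rcons i (fun w => `|word_op T w f|)) -big_split.
by apply: eq_bigr => w _; rewrite (word_op_rcons _ f1) (word_op_rcons _ f2).
Qed.

Lemma Er_norm_le k l f : (k <= l)%N -> N k f <= N l f.
Proof.
move=> kl; rewrite /Er_norm lerD2l (@big_cat_nat _ _ _ k.+1 1 l.+1) //=.
by rewrite lerDl sumr_ge0 // => i _; rewrite sumr_ge0.
Qed.

Lemma norm_le_Er_norm k f : `|f| <= N k f.
Proof. by rewrite -Er_norm0 Er_norm_le. Qed.

Lemma Er_norm_ge0 k f : 0 <= N k f.
Proof. by rewrite (le_trans (normr_ge0 f)) // norm_le_Er_norm. Qed.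

Let h1 := T12_isogroup hT true.
Let h2 := T12_isogroup hT false.

Lemma ErD k f g : Er T k f -> Er T k g ->
  Er T k (f + g) /\ N k (f + g) <= N k f + N k g.
Proof.
elim: k f g => [|k IHk] f g; first by rewrite !Er_norm0; split; [exact: Er0 | exact: ler_normD].
move=> /ErS[f1 [f2 [Af1 Af2 Ef1 Ef2]]] /ErS[g1 [g2 [Ag1 Ag2 Eg1 Eg2]]].
have D1 := gen_graphD h1 Af1 Ag1; have D2 := gen_graphD h2 Af2 Ag2.
have [I1 J1] := IHk _ _ Ef1 Eg1; have [I2 J2] := IHk _ _ Ef2 Eg2.
split; first by apply/ErS; exists (f1 + g1), (f2 + g2).
rewrite (Er_normS _ D1 D2) (Er_normS _ Af1 Af2) (Er_normS _ Ag1 Ag2).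
have := ler_normD f g; lra.
Qed.

Lemma ErZ k c f : Er T k f -> Er T k (c *: f) /\ N k (c *: f) = `|c| * N k f.
Proof.
elim: k f => [|k IHk] f; first by rewrite !Er_norm0 normrZ; split => //; exact: Er0.
move=> /ErS[f1 [f2 [Af1 Af2 Ef1 Ef2]]].
have D1 := gen_graphZ (c := c) h1 Af1; have D2 := gen_graphZ (c := c) h2 Af2.
have [I1 J1] := IHk _ Ef1; have [I2 J2] := IHk _ Ef2.
split; first by apply/ErS; exists (c *: f1), (c *: f2).
by rewrite (Er_normS _ D1 D2) (Er_normS _ Af1 Af2) normrZ J1 J2; ring.
Qed.

Lemma ErB k f g : Er T k f -> Er T k g ->
  Er T k (f - g) /\ N k (f - g) <= N k f + N k g.
Proof.
move=> Ef /(ErZ (-1))[Eg Ng]; have [ED ND] := ErD Ef Eg.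
by rewrite -scaleN1r; split => //; rewrite (le_trans ND) // Ng normrN1 mul1r.
Qed.

Lemma Er_zero k : Er T k 0.
Proof.
elim: k => [|k IHk]; first exact: Er0.
by apply/ErS; exists 0, 0; split => //; exact: gen_graph0.
Qed.

Lemma Er_norm_zero k : N k 0 = 0.
Proof. by rewrite -(scale0r 0) (ErZ 0 (@Er_zero k)).2 normr0 mul0r. Qed.

Lemma Er_norm_distC k f g : Er T k f -> Er T k g -> N k (f - g) = N k (g - f).
Proof.
move=> Ef Eg; have [EB _] := ErB Ef Eg.
by rewrite -(opprB f g) -(scaleN1r (f - g)) (ErZ (-1) EB).2 normrN1 mul1r.
Qed.

(** The images of [h_] under each generator are Cauchy one order lower, so they converge, and
    closedness identifies their limits with the images of [f]. *)
Lemma Er_complete k (h_ : nat -> E) f : h_ @ \oo --> f -> (forall n, Er T k (h_ n)) ->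
  (forall e : R, 0 < e -> exists n0, forall m n, (n0 <= m)%N -> (n0 <= n)%N ->
     N k (h_ m - h_ n) <= e) ->
  Er T k f /\ (forall e : R, 0 < e -> exists n0, forall n, (n0 <= n)%N ->
     N k (f - h_ n) <= e).
Proof.
elim: k h_ f => [|k IHk] h_ f cvh Eh CC.
  split=> [|e e0]; first exact: Er0.
  have /cvgrPdist_le /(_ e e0) [n0 _ H] := cvh; exists n0 => n n0n.
  by rewrite Er_norm0; apply: H.
have Hg n : exists p : E * E, [/\ A1 (h_ n) p.1, A2 (h_ n) p.2, Er T k p.1 & Er T k p.2].
  by have /ErS[g1 [g2 H]] := Eh n; exists (g1, g2).
have /choice[g Hgn] := Hg.
have Nmn m n : N k.+1 (h_ m - h_ n) =
    `|h_ m - h_ n| + (N k ((g m).1 - (g n).1) + N k ((g m).2 - (g n).2)).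
  have [Am1 Am2 _ _] := Hgn m; have [An1 An2 _ _] := Hgn n.
  apply: Er_normS.
    exact: (gen_graphB h1).
  exact: (gen_graphB h2).
have cvgc (u : nat -> E) : (forall e : R, 0 < e -> exists n0, forall m n,
     (n0 <= m)%N -> (n0 <= n)%N -> N k (u m - u n) <= e) -> cvg (u @ \oo).
  move=> Hu; apply/cauchy_cvgP/cauchy_exP => e e0.
  have e2 : 0 < e / 2 by lra.
  have [n0 Hn0] := Hu _ e2; exists (u n0); exists n0 => // m /= nm.
  rewrite -ball_normE /=; apply: (@le_lt_trans _ _ (e / 2)); last lra.
  by rewrite (le_trans (norm_le_Er_norm k _)) // Hn0.
have C1 : forall e : R, 0 < e -> exists n0, forall m n,
     (n0 <= m)%N -> (n0 <= n)%N -> N k ((g m).1 - (g n).1) <= e.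
  move=> e e0; have [n0 H] := CC e e0; exists n0 => m n hm hn.
  have := H m n hm hn; rewrite Nmn; have := normr_ge0 (h_ m - h_ n).
  have := Er_norm_ge0 k ((g m).2 - (g n).2); lra.
have C2 : forall e : R, 0 < e -> exists n0, forall m n,
     (n0 <= m)%N -> (n0 <= n)%N -> N k ((g m).2 - (g n).2) <= e.
  move=> e e0; have [n0 H] := CC e e0; exists n0 => m n hm hn.
  have := H m n hm hn; rewrite Nmn; have := normr_ge0 (h_ m - h_ n).
  have := Er_norm_ge0 k ((g m).1 - (g n).1); lra.
have /cvg_ex[/= l1 cv1] := cvgc _ C1; have /cvg_ex[/= l2 cv2] := cvgc _ C2.
have [I1 J1] := IHk _ _ cv1 (fun n => let: And4 _ _ x _ := Hgn n in x) C1.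
have [I2 J2] := IHk _ _ cv2 (fun n => let: And4 _ _ _ x := Hgn n in x) C2.
have L1 := gen_graph_closed h1 cvh cv1 (fun n => let: And4 x _ _ _ := Hgn n in x).
have L2 := gen_graph_closed h2 cvh cv2 (fun n => let: And4 _ x _ _ := Hgn n in x).
split; first by apply/ErS; exists l1, l2.
move=> e e0; have e3 : 0 < e / 3 by lra.
have [n1 H1] := J1 _ e3; have [n2 H2] := J2 _ e3.
have /cvgrPdist_le /(_ _ e3) [n3 _ H3] := cvh.
exists (maxn n1 (maxn n2 n3)) => n; rewrite !geq_max => /andP[hn1 /andP[hn2 hn3]].
have [An1 An2 _ _] := Hgn n.
rewrite (Er_normS _ (gen_graphB h1 L1 An1) (gen_graphB h2 L2 An2)).
have := H1 n hn1; have := H2 n hn2; have /= := H3 n hn3; lra.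
Qed.

End SmoothSpaces.

(** * Bernstein and Jackson inequalities *)

Section Jackson.
Context (R : realType) (E : completeNormedModType R) (T : R -> R -> E -> E).
Hypothesis hT : is_axb_contraction_rep T.

Notation A1 := (gen_graph (T12 T true)).
Notation A2 := (gen_graph (T12 T false)).
Notation N := (Er_norm T).
Let h1 := T12_isogroup hT true.
Let h2 := T12_isogroup hT false.

(** At k = 0 the constant 5 is 2 + 2 from the two generators and 1 from t|f| <= |f|, which is where
    t <= 1 enters; higher orders follow from [Er_normS]. *)
Lemma Er_norm_landau k t f : 0 < t <= 1 -> Er T k.+2 f ->
  t * N k.+1 f <= 5 * (N k f + t ^+ 2 * N k.+2 f).
Proof.
move=> /andP[t0 t1]; elim: k f => [|k IHk] f.
  move=> /ErS[g1 [g2 [f1 f2 /ErS[g11 [g12 [Ag11 Ag12 _ _]]] /ErS[g21 [g22 [Ag21 Ag22 _ _]]]]]].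
  rewrite !(Er_normS _ f1 f2) (Er_normS _ Ag11 Ag12) (Er_normS _ Ag21 Ag22) !Er_norm0.
  have L1 := gen_graph_landau h1 f1 Ag11 t0.
  have L2 := gen_graph_landau h2 f2 Ag22 t0.
  have {}L1 := ler_wpM2l (ltW t0) L1; have {}L2 := ler_wpM2l (ltW t0) L2.
  rewrite mulrDr in L1; rewrite mulrDr in L2.
  have E1 : t * (2 * t^-1 * `|f|) = 2 * `|f| by field; rewrite gt_eqF.
  have E2 x : t * (3 * t * x) = 3 * (t ^+ 2 * x) by ring.
  rewrite E1 E2 in L1; rewrite E1 E2 in L2.
  have tt := sqr_ge0 t.
  have tf : t * `|f| <= `|f| by rewrite ler_piMl.
  rewrite !mulrDr.
  have := mulr_ge0 tt (normr_ge0 f); have := mulr_ge0 tt (normr_ge0 g11).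
  have := mulr_ge0 tt (normr_ge0 g12); have := mulr_ge0 tt (normr_ge0 g21).
  have := mulr_ge0 tt (normr_ge0 g22); have := mulr_ge0 tt (normr_ge0 g1).
  have := mulr_ge0 tt (normr_ge0 g2); lra.
move=> /ErS[g1 [g2 [f1 f2 /IHk I1 /IHk I2]]].
rewrite !(Er_normS _ f1 f2).
have tf : t * `|f| <= `|f| by rewrite ler_piMl.
have := mulr_ge0 (sqr_ge0 t) (normr_ge0 f); have := normr_ge0 f; lra.
Qed.

Lemma Er_norm_landau0 k : exists2 C : R, 1 <= C & forall t f, 0 < t <= 1 -> Er T k.+1 f ->
  t ^+ k * N k f <= C * (`|f| + t ^+ k.+1 * N k.+1 f).
Proof.
elim: k => [|k [C C1 IHk]].
  exists 1 => // t f /andP[t0 t1] _; rewrite expr0 !mul1r Er_norm0.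
  by rewrite lerDl mulr_ge0 ?exprn_ge0 ?(ltW t0) // Er_norm_ge0.
(* The induction hypothesis is used at the smaller scale et. With eC = 1/10, the factor 5 of
   [Er_norm_landau] leaves half of the middle term, which moves to the left side. *)
pose e := (10 * C)^-1.
have C0 : 0 < 10 * C by lra.
have e0 : 0 < e by rewrite invr_gt0.
have e1 : e <= 1 by rewrite invf_le1 //; lra.
have eC : e * C = 10^-1 by rewrite /e; field; lra.
exists (10 * C * (e^-1 ^+ k) + 10).
  have : 0 <= 10 * C * (e^-1 ^+ k) by rewrite mulr_ge0 ?exprn_ge0 ?invr_ge0 // ltW.
  lra.
move=> t f /andP[t0 t1] Ef.
have Ef' : Er T k.+1 f by apply: Er_le Ef.
have et : 0 < e * t <= 1 by rewrite mulr_gt0 //= mulr_ile1 // ltW.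
have I := IHk _ _ et Ef'.
have tt : 0 < t <= 1 by rewrite t0.
have L := Er_norm_landau tt Ef.
have tk : 0 < t ^+ k by rewrite exprn_gt0.
have ek : 0 < e ^+ k by rewrite exprn_gt0.
have {}L := ler_wpM2l (ltW tk) L.
have {}I : t ^+ k * N k f <= C * (e^-1 ^+ k * `|f|) + 10^-1 * (t ^+ k.+1 * N k.+1 f).
  rewrite -(ler_pM2l ek) [X in _ <= X]mulrDr.
  have -> : e ^+ k * (t ^+ k * N k f) = (e * t) ^+ k * N k f by rewrite exprMn mulrA.
  apply: le_trans I _; rewrite -eC exprMn [e ^+ k.+1]exprS exprVn.
  by rewrite le_eqVlt; apply/orP; left; apply/eqP; field; rewrite ?gt_eqF.
rewrite !exprS in L I *.
have := normr_ge0 f; have := Er_norm_ge0 T k.+2 f.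
set x := N k f in L I *; set y := N k.+1 f in L I *; set z := N k.+2 f in L *.
set p := e^-1 ^+ k in I *.
have p0 : 0 <= p by rewrite exprn_ge0 // invr_ge0 ltW.
move=> z0 f0.
have tz : 0 <= t * (t * t ^+ k) * z by rewrite !mulr_ge0 // ltW.
have pf : 0 <= p * `|f| by rewrite mulr_ge0.
have pz : 0 <= C * p * (t * (t * t ^+ k) * z) by rewrite mulr_ge0 // mulr_ge0 //; lra.
have L' : t * t ^+ k * y <= 5 * (t ^+ k * x + t * (t * t ^+ k) * z).
  by move: L; rewrite ?expr0; lra.
lra.
Qed.

Lemma Er_norm_interp k m : (k <= m)%N -> exists2 C : R, 0 < C & forall t f, 0 < t ->
  Er T m f -> t ^+ k * N k f <= C * (`|f| + t ^+ m * N m f).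
Proof.
move=> km; suff [C C0 H] : exists2 C : R, 0 < C & forall t f, 0 < t <= 1 ->
    Er T m f -> t ^+ k * N k f <= C * (`|f| + t ^+ m * N m f).
  exists (C + 1) => [|t f t0 Ef]; first lra.
  have tm : 0 <= t ^+ m * N m f by rewrite mulr_ge0 ?exprn_ge0 ?Er_norm_ge0 // ltW.
  have f0 := normr_ge0 f.
  have [t1|t1] := leP t 1.
    have := H t f _ Ef; rewrite t0 t1 => /(_ isT) {}H; lra.
  (* For t > 1 both factors increase with the order. *)
  have : t ^+ k * N k f <= t ^+ m * N m f.
    by rewrite ler_pM ?exprn_ge0 ?Er_norm_ge0 ?Er_norm_le ?(ltW t0) // ler_weXn2l // ltW.
  have : 0 <= C * (`|f| + t ^+ m * N m f) by rewrite mulr_ge0 ?addr_ge0 // ltW.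
  lra.
elim: m km => [|m IHm].
  rewrite leqn0 => /eqP ->; exists 1 => // t f _ _.
  by rewrite mul1r lerDr.
rewrite leq_eqVlt => /predU1P[->|/IHm[C C0 H]].
  exists 1 => // t f _ _; by rewrite mul1r lerDr.
have [C' C'1 H'] := Er_norm_landau0 m.
exists (C + C * C') => [|t f tt Ef]; first by rewrite addr_gt0 ?mulr_gt0 //; lra.
have Ef' : Er T m f by apply: Er_le Ef.
have := H _ _ tt Ef'; have := ler_wpM2l (ltW C0) (H' _ _ tt Ef).
have : 0 <= C * (t ^+ m.+1 * N m.+1 f).
  by case/andP: tt => t0 _; rewrite !mulr_ge0 ?exprn_ge0 ?Er_norm_ge0 // ltW.
lra.
Qed.

(** The curve in the group is (exp(sg), b), and [t] bounds how far it leaves the identity. The sign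
    of [sg] keeps the factor exp(-sg) produced by A_2 at most 1. *)
Definition curve_in (t : R) (sg b : R -> R) : Prop :=
  [/\ continuous sg, continuous b &
      forall s, 0 <= s <= 1 -> (0 <= sg s <= t) /\ (0 <= b s <= t)].

Definition curve_mean (w sg b : R -> R) f : E :=
  mean (fun s => w s *: T (expR (sg s)) (b s) f).

(** * Weighted averages of the representation along a curve *)

Section CurveMean.
Context (sg b : R -> R) (csg : continuous sg) (cb : continuous b).

Lemma curve_mean_integrand_continuous (w : R -> R) f : continuous w ->
  continuous (fun s : R => w s *: T (expR (sg s)) (b s) f).
Proof.
move=> cw s; apply: cvgZ; first exact: cw.
apply: (axb_curve_continuous hT (a := expR \o sg)) => // [x|x].
  by apply: continuous_comp; [exact: csg | exact: continuous_expR].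
exact: expR_gt0.
Qed.

Lemma continuous_weight_exp (w : R -> R) : continuous w ->
  continuous (fun s : R => w s * expR (- sg s)).
Proof.
move=> cw s; apply: cvgM; first exact: cw.
apply: (continuous_comp (f := fun s => - sg s) (g := expR)).
  by apply: cvgN; exact: csg.
exact: continuous_expR.
Qed.

Lemma continuous_weight_bexp (w : R -> R) : continuous w ->
  continuous (fun s : R => w s * b s * expR (- sg s)).
Proof.
by move=> cw; apply: continuous_weight_exp => s; apply: cvgM; [exact: cw | exact: cb].
Qed.

Lemma curve_meanD (w : R -> R) f g : continuous w ->
  curve_mean w sg b (f + g) = curve_mean w sg b f + curve_mean w sg b g.
Proof.
move=> cw; rewrite /curve_mean -meanD; try exact: curve_mean_integrand_continuous.
by congr mean; apply/funext => s /=; rewrite (axbD hT) ?expR_gt0 // scalerDr.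
Qed.

Lemma curve_meanB (w : R -> R) f g : continuous w ->
  curve_mean w sg b (f - g) = curve_mean w sg b f - curve_mean w sg b g.
Proof.
move=> cw; rewrite curve_meanD //; congr (_ + _).
rewrite -scaleN1r /curve_mean -[- lim _]scaleN1r -[RHS]meanZ.
  congr mean; apply/funext => s /=.
  by rewrite (axbZ hT) ?expR_gt0 // !scalerA mulrC.
exact: curve_mean_integrand_continuous.
Qed.

Lemma gen_graph2_curve_mean (w : R -> R) f g : continuous w -> A2 f g ->
  A2 (curve_mean w sg b f) (curve_mean (fun s => w s * expR (- sg s)) sg b g).
Proof.
move=> cw fg; apply: (gen_graph_mean h2).
- exact: curve_mean_integrand_continuous.
- by apply: curve_mean_integrand_continuous; exact: continuous_weight_exp.
move=> s _; rewrite -scalerA expRN; apply: (gen_graphZ h2).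
by apply: (gen_graph2_axb hT) => //; exact: expR_gt0.
Qed.

Lemma gen_graph1_curve_mean (w : R -> R) f g1 g2 : continuous w -> A1 f g1 -> A2 f g2 ->
  A1 (curve_mean w sg b f) (curve_mean w sg b g1 +
     curve_mean (fun s => w s * b s * expR (- sg s)) sg b g2).
Proof.
move=> cw f1 f2; have c1 := curve_mean_integrand_continuous (f := g1) cw.
have c2 := curve_mean_integrand_continuous (f := g2) (continuous_weight_bexp cw).
rewrite /curve_mean -meanD //; apply: (gen_graph_mean h1).
- exact: curve_mean_integrand_continuous.
- by move=> s; apply: cvgD; [exact: c1 | exact: c2].
move=> s _ /=; rewrite -!scalerA -scalerDr expRN scalerA; apply: (gen_graphZ h1).
by apply: (gen_graph1_axb hT) => //; exact: expR_gt0.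
Qed.

Lemma curve_mean_le (w : R -> R) W f : continuous w ->
  (forall s, 0 <= s <= 1 -> `|w s| <= W) -> `|curve_mean w sg b f| <= W * `|f|.
Proof.
move=> cw wW; rewrite -[curve_mean _ _ _ _]subr0.
apply: mean_le; first exact: curve_mean_integrand_continuous.
move=> s hs; rewrite subr0 normrZ ler_pM //; first exact: wW.
by rewrite (axb_le hT) // expR_gt0.
Qed.

(** The new weights w exp(-sg) and w b exp(-sg) are again bounded by [W], since sg >= 0 and 0 <= b
    <= 1. The factor 2 per order arises because averages of A_2 f occur under both generators. *)
Lemma Er_curve_mean k (w : R -> R) (W : R) f : curve_in 1 sg b -> continuous w ->
  (forall s, 0 <= s <= 1 -> `|w s| <= W) -> Er T k f ->
  Er T k (curve_mean w sg b f) /\ N k (curve_mean w sg b f) <= 2 ^+ k * W * N k f.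
Proof.
move=> [_ _ crv]; elim: k w f => [|k IHk] w f cw wW.
  move=> _; split; first exact: Er0.
  by rewrite expr0 mul1r !Er_norm0; exact: curve_mean_le.
move=> /ErS[g1 [g2 [f1 f2 E1 E2]]].
have W0 : 0 <= W by rewrite (le_trans _ (wW 0 _)) // lexx ler01.
have w2W s : 0 <= s <= 1 -> `|w s * expR (- sg s)| <= W.
  move=> hs; have [/andP[s0 _] _] := crv s hs.
  rewrite normrM -[W]mulr1 ler_pM //; first exact: wW.
  by rewrite ger0_norm ?expR_ge0 // -expR0 ler_expR oppr_le0.
have w3W s : 0 <= s <= 1 -> `|w s * b s * expR (- sg s)| <= W.
  move=> hs; have [/andP[s0 _] /andP[b0 b1]] := crv s hs.
  rewrite mulrAC normrM -[W]mulr1 ler_pM //; first exact: w2W.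
  by rewrite ger0_norm.
have [P1 Q1] := IHk _ _ cw wW E1.
have [P2 Q2] := IHk _ _ (continuous_weight_bexp cw) w3W E2.
have [P3 Q3] := IHk _ _ (continuous_weight_exp cw) w2W E2.
have Q0 : `|curve_mean w sg b f| <= W * `|f|.
  exact: curve_mean_le.
have E3 := ErD hT P1 P2.
split.
  apply/ErS; do 2 eexists; split; [exact: (gen_graph1_curve_mean cw f1 f2)
    | exact: (gen_graph2_curve_mean cw f2) | exact: E3.1 | exact: P3].
rewrite (Er_normS _ (gen_graph1_curve_mean cw f1 f2) (gen_graph2_curve_mean cw f2)).
rewrite (Er_normS _ f1 f2) exprS.
have [_ ] := E3.
have p2 : 1 <= 2 ^+ k :> R by rewrite exprn_ege1 // ler1n.
have W1 : W <= 2 ^+ k * W by rewrite ler_peMl.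
have Wf : W * `|f| <= 2 ^+ k * W * `|f| by rewrite ler_wpM2r.
have := mulr_ge0 (mulr_ge0 (le_trans ler01 p2) W0) (normr_ge0 f).
have := mulr_ge0 (mulr_ge0 (le_trans ler01 p2) W0) (Er_norm_ge0 T k g1).
lra.
Qed.

End CurveMean.

Lemma axb_near_id sg b t f g1 g2 : 0 <= sg <= t -> 0 <= b <= t ->
  A1 f g1 -> A2 f g2 ->
  `|T (expR sg) b f - f| <= 3 * t * (`|g1| + `|g2|).
Proof.
move=> /andP[s0 st] /andP[b0 bt] f1 f2.
have -> : T (expR sg) b f - f = T12 T false b (T12 T true sg f - f) + (T12 T false b f - f).
  rewrite (isogroupB h2) addrA subrK /T12 (axbM hT) ?expR_gt0 //.
  by rewrite mul1r mulr0 add0r.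
rewrite (le_trans (ler_normD _ _)) // (isogroup_norm h2).
have := gen_graph_lip h1 f1 s0; have := gen_graph_lip h2 f2 b0.
have := ler_wpM2r (normr_ge0 g1) st; have := ler_wpM2r (normr_ge0 g2) bt; lra.
Qed.

(** The induction runs over all [c]: A_2 turns the weight w into w exp(-sg), whose distance from 1
    is larger by at most [t], so the hypothesis is needed for c + 1 as well. *)
Lemma Er_curve_mean_approx k : forall c : R, 0 <= c -> exists2 C : R, 0 < C &
  forall (t : R) (w sg b : R -> R) f, 0 < t <= 1 -> curve_in t sg b -> continuous w ->
  (forall s, 0 <= s <= 1 -> 0 <= w s <= 1 /\ `|w s - 1| <= c * t) -> Er T k.+1 f ->
  N k (f - curve_mean w sg b f) <= C * t * N k.+1 f.
Proof.
have base c (t : R) (w sg b : R -> R) f : 0 <= c -> 0 < t <= 1 -> curve_in t sg b -> continuous w ->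
    (forall s, 0 <= s <= 1 -> 0 <= w s <= 1 /\ `|w s - 1| <= c * t) -> Er T 1 f ->
    `|f - curve_mean w sg b f| <= (c + 3) * t * N 1 f.
  move=> c0 /andP[t0 t1] [csg cb crv] cw ww /ErS[g1 [g2 [f1 f2 _ _]]].
  rewrite distrC; apply: mean_le; first exact: curve_mean_integrand_continuous.
  move=> s hs; have [/andP[w0 w1] wc] := ww s hs; have [sgs bs] := crv s hs.
  have -> : w s *: T (expR (sg s)) (b s) f - f =
     w s *: (T (expR (sg s)) (b s) f - f) + (w s - 1) *: f by lmodule R.
  rewrite (le_trans (ler_normD _ _)) // !normrZ (ger0_norm w0).
  have A := axb_near_id sgs bs f1 f2.
  have B : w s * `|T (expR (sg s)) (b s) f - f| <= 3 * t * (`|g1| + `|g2|).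
    by rewrite (le_trans _ A) // ler_piMl.
  have C := ler_wpM2r (normr_ge0 f) wc.
  rewrite (Er_normS _ f1 f2) !Er_norm0.
  have := mulr_ge0 (mulr_ge0 c0 (ltW t0)) (normr_ge0 g1).
  have := mulr_ge0 (mulr_ge0 c0 (ltW t0)) (normr_ge0 g2).
  have := mulr_ge0 (ltW t0) (normr_ge0 f); lra.
elim: k => [|k IHk] c c0.
  exists (c + 3); first lra.
  by move=> t w sg b f ht hc cw ww Ef; rewrite Er_norm0; exact: base.
have [C1 C10 H1] := IHk c c0.
have c10 : 0 <= c + 1 by lra.
have [C2 C20 H2] := IHk (c + 1) c10.
have p2 : 0 < 2 ^+ k :> R by rewrite exprn_gt0.
exists (c + 3 + C1 + C2 + 2 ^+ k); first lra.
move=> t w sg b f ht hc cw ww Ef.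
have /andP[t0 t1] := ht; have [csg cb crv] := hc.
have := base _ _ _ _ _ _ c0 ht hc cw ww (Er_le (isT : (1 <= k.+2)%N) Ef).
move: Ef => /ErS[g1 [g2 [f1 f2 E1 E2]]].
have B1 := H1 _ _ _ _ _ ht hc cw ww E1.
have w2W s : 0 <= s <= 1 -> 0 <= w s * expR (- sg s) <= 1 /\
    `|w s * expR (- sg s) - 1| <= (c + 1) * t.
  move=> hs; have [/andP[s0 st] _] := crv s hs; have [/andP[w0 w1] wc] := ww s hs.
  have e0 := expR_ge0 (- sg s).
  have e1 : expR (- sg s) <= 1 by rewrite -expR0 ler_expR oppr_le0.
  have e2 : `|expR (- sg s) - 1| <= t.
    by rewrite ler0_norm; [have := expR_ge1Dx (- sg s); lra | lra].
  split; first by rewrite mulr_ge0 //= mulr_ile1.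
  have -> : w s * expR (- sg s) - 1 = expR (- sg s) * (w s - 1) + (expR (- sg s) - 1) by ring.
  rewrite (le_trans (ler_normD _ _)) // normrM (ger0_norm e0).
  have : expR (- sg s) * `|w s - 1| <= `|w s - 1| by rewrite ler_piMl.
  lra.
have cw2 : continuous (fun s : R => w s * expR (- sg s)) by exact: continuous_weight_exp.
have B2 := H2 _ _ _ _ _ ht hc cw2 w2W E2.
have cw3 : continuous (fun s : R => w s * b s * expR (- sg s)) by exact: continuous_weight_bexp.
(* The additional A_2 average created by A_1 has a weight of size at most [t], so its norm bound is
   already of the required order. *)
have w3W s : 0 <= s <= 1 -> `|w s * b s * expR (- sg s)| <= t.
  move=> hs; have [_ /andP[b0 bt]] := crv s hs; have [/andP[ws0 ws1] _] := w2W s hs.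
  have wb0 : 0 <= w s * expR (- sg s) * b s by apply: mulr_ge0.
  by rewrite mulrAC (ger0_norm wb0) (le_trans _ bt) // ler_piMl.
have hc1 : curve_in 1 sg b.
  by split=> // s hs; have [? ?] := crv s hs; split; lra.
have [E3 B3] := Er_curve_mean csg cb hc1 cw3 w3W (Er_le (leqnSn _) E2).
have ww1 s : 0 <= s <= 1 -> `|w s| <= 1.
  by move=> /ww[/andP[w0 w1] _]; rewrite ger0_norm.
have [E4 B4] := Er_curve_mean csg cb hc1 cw ww1 (Er_le (leqnSn _) E1).
have D1 := gen_graphB h1 f1 (gen_graph1_curve_mean csg cb cw f1 f2).
have D2 := gen_graphB h2 f2 (gen_graph2_curve_mean csg cb cw f2).
rewrite (Er_normS _ D1 D2) !(Er_normS _ f1 f2) opprD [X in N k X + _]addrA.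
have [E5 _] := ErB hT (Er_le (leqnSn _) E1) E4.
have [_ B5] := ErB hT E5 E3.
have B6 := Er_norm_le T g2 (leqnSn k).
have n1 := Er_norm_ge0 T k.+1 g1; have n2 := Er_norm_ge0 T k.+1 g2.
have n0 := normr_ge0 f; have n3 := Er_norm_ge0 T k g2.
have n4 := Er_norm_le T g1 (isT : (0 <= k.+1)%N).
have n5 := Er_norm_le T g2 (isT : (0 <= k.+1)%N).
have p1 : 2 ^+ k * t * N k g2 <= 2 ^+ k * t * N k.+1 g2.
  by rewrite ler_wpM2l // mulr_ge0 // ltW.
have q0 : 0 <= (c + 3) * t by rewrite mulr_ge0 ?(ltW t0) //; lra.
have r1 := ler_wpM2l q0 n4; have r2 := ler_wpM2l q0 n5.
move=> A.
set M := N k.+1 g1 in n1 r1 B1 *; set M' := N k.+1 g2 in n2 r2 B2 p1 *.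
have s1 x y : 0 <= x -> 0 <= y -> 0 <= x * t * y by move=> x0 y0; rewrite !mulr_ge0 // ltW.
have := s1 _ _ (ltW C10) n0; have := s1 _ _ (ltW C20) n0; have := s1 _ _ (ltW p2) n0.
have := s1 _ _ (ltW C10) n2; have := s1 _ _ (ltW C20) n1; have := s1 _ _ (ltW p2) n1.
lra.
Qed.

(** A single operator is the average along a constant curve. *)
Lemma Er_axb k (s u : R) f : 0 <= s <= 1 -> 0 <= u <= 1 -> Er T k f ->
  Er T k (T (expR s) u f) /\ N k (T (expR s) u f) <= 2 ^+ k * N k f.
Proof.
move=> hs hu Ef; have cst_c (c : R) : continuous (fun _ : R => c) by move=> x; exact: cvg_cst.
have -> : T (expR s) u f = curve_mean (fun=> 1) (fun=> s) (fun=> u) f.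
  rewrite -[LHS]mean_cst; congr mean; apply/funext => x.
  by rewrite scale1r.
have hc : curve_in 1 (fun=> s) (fun=> u) by split.
have := Er_curve_mean (cst_c s) (cst_c u) hc (cst_c 1) (W := 1) _ Ef.
rewrite mulr1; apply=> x _; by rewrite normr1.
Qed.

(** * Steklov averages of the two one-parameter groups *)

Definition steklov1 (t : R) f := curve_mean (fun=> 1) (fun s => s * t) (fun=> 0) f.
Definition steklov2 (t : R) f := curve_mean (fun=> 1) (fun=> 0) (fun s => s * t) f.
(** In this order A_1 meets its own average at once, while A_2 passes through [steklov1] with only a
    change of the scalar weight and then meets [steklov2]. *)
Definition smoothing t f := steklov1 t (steklov2 t f).

Lemma gen_graph_steklov1 t f : 0 < t -> A1 (steklov1 t f) (t^-1 *: (T12 T true t f - f)).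
Proof.
move=> t0; have := gen_graph_mean_orbit (f := f) h1 t0.
suff -> : steklov1 t f = mean (fun s : R => T12 T true (s * t) f) by [].
by congr mean; apply/funext => s; rewrite scale1r.
Qed.

Lemma gen_graph_steklov2 t f : 0 < t -> A2 (steklov2 t f) (t^-1 *: (T12 T false t f - f)).
Proof.
move=> t0; have := gen_graph_mean_orbit (f := f) h2 t0.
suff -> : steklov2 t f = mean (fun s : R => T12 T false (s * t) f) by [].
by congr mean; apply/funext => s; rewrite scale1r expR0.
Qed.

Section Smoothing.
Context (t : R) (ht : 0 < t <= 1).
Let t0 : 0 < t. Proof. by case/andP: ht. Qed.

Let cst_c (c : R) : continuous (fun _ : R => c).
Proof. by move=> x; exact: cvg_cst. Qed.

Let lin_c : continuous (fun s : R => s * t).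
Proof. by move=> s; apply: cvgM; [exact: cvg_id | exact: cvg_cst]. Qed.

Let lin_in s : 0 <= s <= 1 -> 0 <= s * t <= t.
Proof. by move=> /andP[s0 s1]; rewrite mulr_ge0 ?(ltW t0) //= ler_piMl // ltW. Qed.

Let z_in : 0 <= (0 : R) <= t. Proof. by rewrite lexx ltW. Qed.

Let hc1 : curve_in t (fun s => s * t) (fun=> 0).
Proof. by split => // s hs; split => //; exact: lin_in. Qed.

Let hc2 : curve_in t (fun=> 0) (fun s => s * t).
Proof. by split => // s hs; split => //; exact: lin_in. Qed.

Lemma curve_in_le1 sg b : curve_in t sg b -> curve_in 1 sg b.
Proof.
case=> csg cb H; split=> // s hs; have [? ?] := H s hs; have /andP[_ t1] := ht.
by split; lra.
Qed.

Let w1 (s : R) : 0 <= s <= 1 -> `|1 : R| <= (1 : R).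
Proof. by rewrite normr1. Qed.

Lemma Er_steklov1 k f : Er T k f ->
  Er T k (steklov1 t f) /\ N k (steklov1 t f) <= 2 ^+ k * N k f.
Proof.
move=> Ef; have := Er_curve_mean lin_c (@cst_c 0) (curve_in_le1 hc1) (@cst_c 1) w1 Ef.
by rewrite mulr1.
Qed.

Lemma Er_steklov2 k f : Er T k f ->
  Er T k (steklov2 t f) /\ N k (steklov2 t f) <= 2 ^+ k * N k f.
Proof.
move=> Ef; have := Er_curve_mean (@cst_c 0) lin_c (curve_in_le1 hc2) (@cst_c 1) w1 Ef.
by rewrite mulr1.
Qed.

Lemma Er_smoothing k f : Er T k f ->
  Er T k (smoothing t f) /\ N k (smoothing t f) <= 4 ^+ k * N k f.
Proof.
move=> /Er_steklov2[E2 N2]; have [E1 N1] := Er_steklov1 E2; split=> //.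
apply: le_trans N1 _; have -> : 4 = 2 * 2 :> R by ring.
by rewrite exprMn -mulrA ler_wpM2l // exprn_ge0.
Qed.

(** Each generator applied to its own average is a difference quotient, which costs 1/t and no
    smoothness of [f]. *)
Lemma Er_smoothingS k f : Er T k f -> Er T k.+1 (smoothing t f) /\
  t * N k.+1 (smoothing t f) <= 4 ^+ k.+2 * N k f.
Proof.
move=> Ef; have [E2 N2] := Er_steklov2 Ef.
have D1 := gen_graph_steklov1 (f := steklov2 t f) t0.
have D2 := gen_graph2_curve_mean lin_c (@cst_c 0) (@cst_c 1) (gen_graph_steklov2 (f := f) t0).
have hs1 : 0 <= (1 : R) <= 1 by rewrite ler01 lexx.
have h01 : 0 <= (0 : R) <= 1 by rewrite ler01 lexx.
have ht1 : 0 <= t <= 1 by case/andP: ht => _ ->; rewrite ltW.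
have p1 : 1 <= 2 ^+ k :> R by rewrite exprn_ege1 // ler1n.
have diff j g : Er T k g -> Er T k (t^-1 *: (T12 T j t g - g)) /\
    t * N k (t^-1 *: (T12 T j t g - g)) <= 2 * 2 ^+ k * N k g.
  move=> Eg; have [Ej Nj] : Er T k (T12 T j t g) /\ N k (T12 T j t g) <= 2 ^+ k * N k g.
    case: j; first exact: Er_axb.
    by have := Er_axb h01 ht1 Eg; rewrite expR0.
  have [Ed Nd] := ErB hT Ej Eg; have [Ez Nz] := ErZ hT t^-1 Ed.
  split => //; rewrite Nz gtr0_norm ?invr_gt0 // mulrA divff ?gt_eqF // mul1r.
  have : N k g <= 2 ^+ k * N k g by rewrite ler_peMl // Er_norm_ge0.
  lra.
have [F1 M1] := diff true _ E2.
have [F2 M2] := diff false _ Ef.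
have wW s : 0 <= s <= 1 -> `|1 * expR (- (s * t))| <= 1.
  move=> hs; have /andP[st _] := lin_in hs.
  by rewrite mul1r ger0_norm ?expR_ge0 // -expR0 ler_expR oppr_le0.
have cw : continuous (fun s : R => 1 * expR (- (s * t))).
  exact: (continuous_weight_exp lin_c (@cst_c 1)).
have [F3 M3] := Er_curve_mean lin_c (@cst_c 0) (curve_in_le1 hc1) cw wW F2.
split.
  apply/ErS; do 2 eexists; split; [exact: D1 | exact: D2 | exact: F1 | exact: F3].
rewrite (Er_normS _ D1 D2).
have [_ N0] := Er_smoothing (@Er0 _ _ T f).
rewrite !Er_norm0 expr0 mul1r in N0.
have tN0 : t * `|smoothing t f| <= N k f.
  have /andP[_ t1] := ht.
  rewrite (le_trans (ler_wpM2l (ltW t0) N0)) // (le_trans _ (norm_le_Er_norm T k f)) //.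
  by rewrite ler_piMl.
have nf := Er_norm_ge0 T k f.
have M3' := ler_wpM2l (ltW t0) M3; rewrite mulr1 mulrCA in M3'.
have p0 : 0 <= 2 ^+ k :> R by lra.
have M2' := ler_wpM2l p0 M2.
have pp : 1 <= (2 ^+ k) ^+ 2 :> R by rewrite exprn_ege1.
have N2' := ler_wpM2l p0 N2.
have -> : 4 ^+ k.+2 = 16 * (2 ^+ k) ^+ 2 :> R.
  have -> : (2 ^+ k) ^+ 2 = 4 ^+ k :> R.
    by rewrite exprAC; congr (_ ^+ k); rewrite expr2; ring.
  by rewrite !exprS; ring.
have := ler_wpM2r nf pp.
move: M1 M2' M3' N2' tN0; rewrite expr2; move: (2 ^+ k) => p M1 M2' M3' N2' tN0 H.
rewrite /smoothing in tN0 *; lra.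
Qed.

End Smoothing.

(** Uses f - M_1 M_2 f = (f - M_1 f) + M_1 (f - M_2 f) and the approximation estimate with weight 1,
    that is with c = 0. *)
Lemma smoothing_approx k : exists2 C : R, 0 < C & forall t f, 0 < t <= 1 -> Er T k.+1 f ->
  N k (f - smoothing t f) <= C * t * N k.+1 f.
Proof.
have [C C0 HC] := Er_curve_mean_approx k (lexx 0).
exists (C + 2 ^+ k * C) => [|t f ht Ef]; first by rewrite addr_gt0 ?mulr_gt0 ?exprn_gt0.
have /andP[t0 t1] := ht.
have cst_c (c : R) : continuous (fun _ : R => c) by move=> x; exact: cvg_cst.
have lin_c : continuous (fun s : R => s * t).
  by move=> s; apply: cvgM; [exact: cvg_id | exact: cvg_cst].
have lin_in s : 0 <= s <= 1 -> 0 <= s * t <= t.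
  by move=> /andP[s0 s1]; rewrite mulr_ge0 ?(ltW t0) //= ler_piMl // ltW.
have z_in : 0 <= (0 : R) <= t by rewrite lexx ltW.
have hc1 : curve_in t (fun s => s * t) (fun=> 0).
  by split => // s hs; split => //; exact: lin_in.
have hc2 : curve_in t (fun=> 0) (fun s => s * t).
  by split => // s hs; split => //; exact: lin_in.
have ww (s : R) : 0 <= s <= 1 -> 0 <= (1 : R) <= 1 /\ `|(1 : R) - 1| <= 0 * t.
  by rewrite ler01 lexx subrr normr0 mul0r.
have B1 := HC t (fun=> 1) _ _ f ht hc1 (@cst_c 1) ww Ef.
have B2 := HC t (fun=> 1) _ _ f ht hc2 (@cst_c 1) ww Ef.
have Ef' := Er_le (leqnSn k) Ef.
have [E2 N2] := Er_steklov2 ht Ef'.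
have [E3 _] := ErB hT Ef' E2.
have [E4 N4] := Er_steklov1 ht E3.
have [E5 _] := ErB hT Ef' (Er_steklov1 ht Ef').1.
have -> : f - smoothing t f = (f - steklov1 t f) + steklov1 t (f - steklov2 t f).
  have -> : steklov1 t (f - steklov2 t f) = steklov1 t f - smoothing t f.
    exact: curve_meanB.
  by lmodule R.
rewrite (le_trans (ErD hT E5 E4).2) // mulrDl mulrDl lerD //.
apply: le_trans N4 _; rewrite -!mulrA ler_wpM2l ?exprn_ge0 //.
by rewrite mulrA.
Qed.

(** * Iterated smoothing and the Jackson inequality *)

Lemma Er_iter_smoothing k m t f : 0 < t <= 1 -> Er T k f ->
  Er T k (iter m (smoothing t) f) /\
  N k (iter m (smoothing t) f) <= (4 ^+ k) ^+ m * N k f.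
Proof.
move=> ht Ef; elim: m => [|m [Em Nm]]; first by rewrite expr0 mul1r.
have [E1 N1] := Er_smoothing ht Em; split => //=.
by rewrite (le_trans N1) // exprS -mulrA ler_wpM2l // exprn_ge0.
Qed.

Lemma iter_smoothing_approx k m : exists2 C : R, 0 < C & forall t f, 0 < t <= 1 ->
  Er T k.+1 f -> N k (f - iter m (smoothing t) f) <= C * t * N k.+1 f.
Proof.
have [C C0 HC] := smoothing_approx k.
elim: m => [|m [C' C'0 IHm]].
  exists 1 => // t f /andP[t0 _] Ef; rewrite /= subrr (@Er_norm_zero _ _ _ hT).
  by rewrite mul1r mulr_ge0 ?(ltW t0) // Er_norm_ge0.
exists (C' + C * (4 ^+ k.+1) ^+ m) => [|t f ht Ef].
  by rewrite addr_gt0 // mulr_gt0 // !exprn_gt0.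
have [E1 N1] := Er_iter_smoothing m ht Ef.
set g := iter m _ f in E1 N1 *.
have -> : f - iter m.+1 (smoothing t) f = (f - g) + (g - smoothing t g).
  by rewrite addrA subrK.
have [E2 _] := Er_smoothing ht (Er_le (leqnSn k) E1).
have [E3 _] := ErB hT (Er_le (leqnSn k) E1) E2.
have [E4 _] := ErB hT (Er_le (leqnSn k) Ef) (Er_le (leqnSn k) E1).
rewrite (le_trans (ErD hT E4 E3).2) // !mulrDl lerD //; first exact: IHm.
rewrite (le_trans (HC _ _ ht E1)) //.
have /andP[t0 _] := ht.
by rewrite -!mulrA ler_wpM2l ?(ltW C0) // mulrCA ler_wpM2l // ltW.
Qed.

Lemma Er_iter_smoothingD k m : exists2 C : R, 0 < C & forall t f, 0 < t <= 1 ->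
  Er T k f -> Er T (k + m) (iter m (smoothing t) f) /\
  t ^+ m * N (k + m) (iter m (smoothing t) f) <= C * N k f.
Proof.
elim: m => [|m [C C0 IHm]].
  by exists 1 => // t f ht Ef; rewrite addn0 expr0.
exists (4 ^+ (k + m).+2 * C) => [|t f ht Ef]; first by rewrite mulr_gt0 // exprn_gt0.
have [E1 N1] := IHm t f ht Ef; have [E2 N2] := Er_smoothingS ht E1.
rewrite addnS; split => //=; have /andP[t0 _] := ht.
have tm : 0 <= t ^+ m by rewrite exprn_ge0 // ltW.
by rewrite exprSr -mulrA (le_trans (ler_wpM2l tm N2)) // mulrCA -mulrA ler_wpM2l.
Qed.

Lemma Er_jackson r k : (k <= r)%N -> exists2 C : R, 0 < C & forall t f, 0 < t ->
  Er T k f -> exists2 f1, Er T r f1 & `|f - f1| + t ^+ r * N r f1 <= C * (t ^+ k * N k f).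
Proof.
move=> kr.
have [Cb Cb0 Hb] := Er_iter_smoothingD k (r - k).
pose Cc : R := (4 ^+ k) ^+ r; have Cc0 : 0 < Cc by rewrite !exprn_gt0.
pose Cd : R := (4 ^+ r) ^+ k; have Cd0 : 0 < Cd by rewrite !exprn_gt0.
(* After [i] rounds f - f1 is the image of [f] under the i-th power of I - S^r; each round trades
   one order for a factor [t]. The last bound keeps the residual under control in E^k, so that its
   smoothed part can be added to [f1]. *)
have step i : (i <= k)%N -> exists2 C : R, 0 < C & forall t f, 0 < t <= 1 -> Er T k f ->
    exists f1, [/\ Er T r f1, N (k - i) (f - f1) <= C * (t ^+ i * N k f),
      t ^+ (r - k) * N r f1 <= C * N k f & N k (f - f1) <= C * N k f].
  elim: i => [|i IHi] ik.
    exists 1 => // t f ht Ef; exists 0; split.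
    - exact: (Er_zero hT).
    - by rewrite subr0 subn0 expr0 !mul1r.
    - by rewrite (Er_norm_zero hT) mulr0 mul1r Er_norm_ge0.
    - by rewrite subr0 mul1r.
  have [C C0 HC] := IHi (ltnW ik).
  have [Ca Ca0 Ha] := iter_smoothing_approx (k - i.+1) r.
  exists (Ca * C + (C + Cd * Cb * C) + (C + Cc * C)) => [|t f ht Ef].
    by rewrite !addr_gt0 ?mulr_gt0.
  have [f1 [E1 N1 N2 N3]] := HC t f ht Ef.
  have /andP[t0 _] := ht.
  have [Eg _] := ErB hT Ef (Er_le kr E1).
  set g := f - f1 in N1 N3 Eg.
  have [EB NB] := Hb t g ht Eg; rewrite subnKC // in EB NB.
  have rE : r = (k + (r - k))%N by rewrite subnKC.
  have [EB' NB'] := Er_iter_smoothing k ht EB.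
  (* Of the [r] smoothings, r - k raise the order from [k] to [r]; the other [k] only cost the
     constant [Cd]. *)
  rewrite -iterD -rE in EB' NB'.
  have nf := Er_norm_ge0 T k f.
  exists (f1 + iter r (smoothing t) g); have [E2 N4] := ErD hT E1 EB'.
  have -> : f - (f1 + iter r (smoothing t) g) = g - iter r (smoothing t) g.
    by rewrite opprD addrA.
  have pos1 : 0 <= Ca * C * N k f by rewrite !mulr_ge0 // ltW.
  have pos2 : 0 <= (C + Cd * Cb * C) * N k f.
    by rewrite mulr_ge0 // addr_ge0 ?mulr_ge0 // ltW.
  have pos3 : 0 <= (C + Cc * C) * N k f by rewrite mulr_ge0 // addr_ge0 ?mulr_ge0 // ltW.
  split => //.
  - have Eg' : Er T (k - i.+1).+1 g by apply: Er_le Eg; rewrite subnSK ?leq_subr.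
    have := Ha t g ht Eg'; rewrite subnSK // => A.
    apply: le_trans A _.
    have q : 0 <= Ca * t by rewrite mulr_ge0 // ltW.
    have := ler_wpM2l q N1.
    have ti : 0 <= t ^+ i.+1 by rewrite exprn_ge0 // ltW.
    have := mulr_ge0 ti pos2; have := mulr_ge0 ti pos3; rewrite exprS; lra.
  - have tr : 0 <= t ^+ (r - k) by rewrite exprn_ge0 // ltW.
    have A1 := ler_wpM2l tr N4.
    have A2 := ler_wpM2l tr NB'; rewrite mulrCA in A2.
    have A3 := ler_wpM2l (ltW Cd0) NB.
    have A4 := ler_wpM2l (mulr_ge0 (ltW Cd0) (ltW Cb0)) N3.
    rewrite -/Cd in A2; lra.
  - have [E5 N5] := Er_iter_smoothing r ht Eg.
    have [_ N6] := ErB hT Eg E5.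
    have A1 := ler_wpM2l (ltW Cc0) N3; rewrite -/Cc in N5; lra.
have [C C0 H] := step k (leqnn k).
exists (2 * C + 1) => [|t f t0 Ef]; first lra.
have tk : 0 <= t ^+ k by rewrite exprn_ge0 // ltW.
have tN : 0 <= t ^+ k * N k f by rewrite mulr_ge0 // Er_norm_ge0.
have [t1|t1] := leP t 1.
  have ht : 0 < t <= 1 by rewrite t0.
  have [f1 [E1 N1 N2 _]] := H t f ht Ef; exists f1 => //.
  rewrite subnn Er_norm0 in N1.
  have := ler_wpM2l tk N2; rewrite mulrA -exprD subnKC // => A; lra.
(* For t > 1 the zero approximant is enough, because |f| <= N_k f <= t^k N_k f. *)
exists 0; first exact: (Er_zero hT).
rewrite subr0 (Er_norm_zero hT) mulr0 addr0.
have A := norm_le_Er_norm T k f.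
have B : N k f <= t ^+ k * N k f.
  by rewrite ler_peMl ?Er_norm_ge0 // exprn_ege1 // ltW.
have := mulr_ge0 (ltW C0) tN; lra.
Qed.

End Jackson.

(** * Reiteration for the K-functional *)

Section KFunctional.
Context (R : realType) (E : completeNormedModType R) (T : R -> R -> E -> E).
Hypothesis hT : is_axb_contraction_rep T.

Notation N := (Er_norm T).
Notation K := (Kfun T).

Lemma Kfun_has_inf k1 k2 t f : 0 <= t -> Er T k1 f ->
  has_inf [set x : R | exists f0 f1 : E, [/\ Er T k1 f0, Er T k2 f1, f = f0 + f1 &
        x = N k1 f0 + t * N k2 f1]].
Proof.
move=> t0 Ef; split.
  exists (N k1 f + t * N k2 0), f, 0; split => //; first exact: (Er_zero hT).
  by rewrite addr0.
exists 0 => x /= [f0 [f1 [_ _ _ ->]]].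
by rewrite addr_ge0 ?mulr_ge0 ?Er_norm_ge0.
Qed.

Lemma Kfun_le k1 k2 t f0 f1 : 0 <= t -> Er T k1 f0 -> Er T k2 f1 ->
  K k1 k2 t (f0 + f1) <= N k1 f0 + t * N k2 f1.
Proof.
move=> t0 E0 E1; apply: ge_inf.
  exists 0 => x /= [g0 [g1 [_ _ _ ->]]].
  by rewrite addr_ge0 ?mulr_ge0 ?Er_norm_ge0.
by exists f0, f1.
Qed.

Lemma le_Kfun k1 k2 t f x : 0 <= t -> Er T k1 f ->
  (forall f0 f1, Er T k1 f0 -> Er T k2 f1 -> f = f0 + f1 ->
     x <= N k1 f0 + t * N k2 f1) -> x <= K k1 k2 t f.
Proof.
move=> t0 Ef H; apply: lb_le_inf; first by case: (Kfun_has_inf k2 t0 Ef).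
by move=> y /= [f0 [f1 [E0 E1 ff ->]]]; apply: H.
Qed.

Lemma Kfun_ge0 k1 k2 t f : 0 <= t -> Er T k1 f -> 0 <= K k1 k2 t f.
Proof.
move=> t0 Ef; apply: le_Kfun => // f0 f1 _ _ _.
by rewrite addr_ge0 ?mulr_ge0 ?Er_norm_ge0.
Qed.

Lemma Kfun_lt k1 k2 t f x : 0 <= t -> Er T k1 f -> K k1 k2 t f < x ->
  exists f1, [/\ Er T k1 (f - f1), Er T k2 f1 & N k1 (f - f1) + t * N k2 f1 < x].
Proof.
move=> t0 Ef Kx; have [_ [f0 [f1 [E0 E1 ff ->]]] lx] := inf_lt (Kfun_has_inf k2 t0 Ef).1 Kx.
by exists f1; rewrite ff addrK.
Qed.

Lemma Kfun_mono k1 k2 s t f : Er T k1 f -> 0 <= s <= t -> K k1 k2 s f <= K k1 k2 t f.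
Proof.
move=> Ef /andP[s0 st]; apply: le_Kfun => //; first exact: le_trans st.
move=> f0 f1 E0 E1 ->; rewrite (le_trans (Kfun_le s0 E0 E1)) // lerD2l.
by rewrite ler_wpM2r // Er_norm_ge0.
Qed.

Lemma Kfun_scale k1 k2 c t f : Er T k1 f -> 0 <= t -> 1 <= c ->
  K k1 k2 (c * t) f <= c * K k1 k2 t f.
Proof.
move=> Ef t0 c1; have c0 : 0 < c by lra.
rewrite -ler_pdivrMl //; apply: le_Kfun => // f0 f1 E0 E1 ->.
rewrite ler_pdivrMl //; have ct : 0 <= c * t by rewrite mulr_ge0 // ltW.
rewrite (le_trans (Kfun_le ct E0 E1)) //.
have -> : c * (N k1 f0 + t * N k2 f1) = c * N k1 f0 + c * t * N k2 f1 by ring.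
rewrite lerD2r.
by rewrite ler_peMl // Er_norm_ge0.
Qed.

(** K(t) increases and K(t)/t decreases in t, which bounds the variation of K near [s] by a multiple
    of |s - t|. Continuity supplies the measurability of the integrands below. *)
Lemma Kfun_continuous k1 k2 s f : Er T k1 f -> 0 < s ->
  {for s, continuous (fun t => K k1 k2 t f)}.
Proof.
move=> Ef s0; apply/cvgrPdist_le => e e0.
have K0 := Kfun_ge0 k2 (ltW s0) Ef; set A := K k1 k2 s f in K0 *.
have d0 : 0 < Num.min (s / 2) (e * s / (2 * (A + 1))).
  rewrite lt_min !divr_gt0 ?mulr_gt0 //; lra.
near=> t.
have : `|s - t| < Num.min (s / 2) (e * s / (2 * (A + 1))).
  by near: t; apply: cvgr_dist_lt.
rewrite lt_min => /andP[ts te].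
have es := mulr_gt0 e0 s0.
have /andP[] : - (s / 2) <= s - t <= s / 2 by rewrite -ler_norml ltW.
move=> ts1 ts2; have t0 : 0 < t by lra.
rewrite ltr_pdivlMr in te; last lra.
have te2 : `|s - t| * A <= e * s / 2 by have := normr_ge0 (s - t); lra.
have [st|st] := leP s t.
  have m : A <= K k1 k2 t f by apply: Kfun_mono; rewrite ?(ltW s0).
  have c1 : 1 <= t / s by rewrite ler_pdivlMr // mul1r.
  have := Kfun_scale k2 Ef (ltW s0) c1; rewrite divfK ?gt_eqF // -/A => m2.
  rewrite distrC ger0_norm; last lra.
  rewrite -(ler_pM2l s0); have := ler_wpM2l (ltW s0) m2.
  have -> : s * (t / s * A) = t * A by field; rewrite gt_eqF.
  rewrite ler0_norm in te2; last lra.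
  lra.
have m : K k1 k2 t f <= A by apply: Kfun_mono => //; rewrite (ltW t0) ltW.
have c1 : 1 <= s / t by rewrite ler_pdivlMr // mul1r ltW.
have := Kfun_scale k2 Ef (ltW t0) c1; rewrite divfK ?gt_eqF // -/A => m2.
rewrite ger0_norm; last lra.
have := ler_wpM2l (ltW t0) m2.
have -> : t * (s / t * K k1 k2 t f) = s * K k1 k2 t f by field; rewrite gt_eqF.
rewrite ger0_norm in te2; last lra.
move=> m3; rewrite -(ler_pM2l s0); lra.
Unshelve. all: by end_near. Qed.

(** Both parts of a decomposition of [f] are replaced by their Jackson approximants at the same
    scale [s], whose sum is the E^r part. *)
Lemma Kfun_0r_le r k1 k2 : (k1 <= k2)%N -> (k2 <= r)%N -> exists2 C : R, 0 < C &
  forall f s, Er T k1 f -> 0 < s ->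
    K 0 r (s ^+ r) f <= C * (s ^+ k1 * K k1 k2 (s ^+ (k2 - k1)) f).
Proof.
move=> k12 k2r.
have [C0 C00 H0] := Er_jackson hT (leq_trans k12 k2r).
have [C1 C10 H1] := Er_jackson hT k2r.
exists (C0 + C1) => [|f s Ef s0]; first by rewrite addr_gt0.
have sk : 0 < s ^+ k1 by rewrite exprn_gt0.
have sr : 0 < s ^+ r by rewrite exprn_gt0.
have CC : 0 < C0 + C1 by rewrite addr_gt0.
rewrite -ler_pdivrMl // -ler_pdivrMl //; apply: le_Kfun => //.
  by rewrite exprn_ge0 // ltW.
move=> f0 f1 E0 E1 ff; rewrite !ler_pdivrMl //.
have [h0 Eh0 B0] := H0 _ _ s0 E0; have [h1 Eh1 B1] := H1 _ _ s0 E1.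
have -> : f = ((f0 - h0) + (f1 - h1)) + (h0 + h1) by rewrite ff; lmodule R.
have [EhD NhD] := ErD hT Eh0 Eh1.
apply: le_trans (Kfun_le (ltW sr) (@Er0 _ _ T _) EhD) _.
rewrite Er_norm0; have := ler_normD (f0 - h0) (f1 - h1).
have := ler_wpM2l (ltW sr) NhD.
have -> : s ^+ k1 * (N k1 f0 + s ^+ (k2 - k1) * N k2 f1) =
    s ^+ k1 * N k1 f0 + s ^+ k2 * N k2 f1.
  by rewrite mulrDr mulrA -exprD subnKC.
have p0 : 0 <= s ^+ k1 * N k1 f0 by rewrite mulr_ge0 ?Er_norm_ge0 // ltW.
have p1 : 0 <= s ^+ k2 * N k2 f1 by rewrite mulr_ge0 ?exprn_ge0 ?Er_norm_ge0 // ltW.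
have := mulr_ge0 (ltW C00) p1; have := mulr_ge0 (ltW C10) p0; lra.
Qed.

(** The induction carries the exact partial sum, with 1 - sg^m in the numerator. *)
Lemma Er_norm_geometric k (x : nat -> E) (D sg : R) : 0 <= sg < 1 -> 0 <= D ->
  (forall n, Er T k (x n)) -> (forall n, N k (x n.+1 - x n) <= D * sg ^+ n) ->
  forall n m, N k (x (n + m)%N - x n) <= D * sg ^+ n / (1 - sg).
Proof.
move=> /andP[s0 s1] D0 Ex H n m; rewrite ler_pdivlMr; last lra.
have sn : 0 <= D * sg ^+ n by rewrite mulr_ge0 // exprn_ge0.
suff : N k (x (n + m)%N - x n) * (1 - sg) <= D * sg ^+ n * (1 - sg ^+ m).
  have : 0 <= D * sg ^+ n * sg ^+ m by rewrite mulr_ge0 // exprn_ge0.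
  lra.
elim: m => [|m IHm].
  by rewrite addn0 subrr (Er_norm_zero hT) mul0r expr0 subrr mulr0.
have -> : x (n + m.+1)%N - x n = (x (n + m).+1 - x (n + m)%N) + (x (n + m)%N - x n).
  by rewrite addnS addrA subrK.
have := (ErD hT (ErB hT (Ex (n + m).+1) (Ex (n + m)%N)).1 (ErB hT (Ex (n + m)%N) (Ex n)).1).2.
have := H (n + m)%N; rewrite exprD mulrA => A B.
have s2 : 0 <= 1 - sg by lra.
have := ler_wpM2r s2 A; have := ler_wpM2r s2 B.
rewrite exprS; lra.
Qed.

Lemma expr_lt_eventually (sg e : R) : 0 <= sg < 1 -> 0 < e ->
  exists n0, forall n, (n0 <= n)%N -> sg ^+ n < e.
Proof.
move=> /andP[s0 s1] e0; have h1 : `|sg| < 1 by rewrite ger0_norm.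
have /cvgrPdist_lt /(_ e e0) [n0 _ H] := cvg_expr h1.
by exists n0 => n /H /=; rewrite sub0r normrN ger0_norm // exprn_ge0.
Qed.

Lemma le_of_geometric (x y z sg : R) : 0 <= sg < 1 -> 0 <= z ->
  (forall n, x <= y + sg ^+ n * z) -> x <= y.
Proof.
move=> hs z0 H; apply/ler_addgt0Pr => e e0.
have z1 : 0 < z + 1 by lra.
have [n0 /(_ n0 (leqnn n0)) Hn] := expr_lt_eventually hs (divr_gt0 e0 z1).
rewrite (le_trans (H n0)) // lerD2l; rewrite ltr_pdivlMr // in Hn.
have /andP[s0 _] := hs.
have := exprn_ge0 n0 s0; lra.
Qed.

(** The Bernstein side at the smaller scale [p]: there |x - y| and p^r N_r (x - y) are both bounded
    by the two approximation errors. *)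
Lemma Er_norm_approximants r k : (k <= r)%N -> exists2 C : R, 0 < C &
  forall f x y p p' A A', 0 < p -> p <= p' -> Er T r x -> Er T r y ->
    `|f - x| + p ^+ r * N r x <= A -> `|f - y| + p' ^+ r * N r y <= A' ->
    p ^+ k * N k (x - y) <= C * (A + A').
Proof.
move=> kr; have [C C0 H] := Er_norm_interp hT kr.
exists C => // f x y p p' A A' p0 pp Ex Ey Hx Hy.
have [ED ND] := ErB hT Ex Ey.
rewrite (le_trans (H _ _ p0 ED)) // ler_wpM2l ?(ltW C0) //.
have pr : 0 <= p ^+ r by rewrite exprn_ge0 // ltW.
have ppr : p ^+ r <= p' ^+ r by rewrite lerXn2r // nnegrE ltW // (lt_le_trans p0).
have := ler_wpM2l pr ND; have := ler_wpM2r (Er_norm_ge0 T r y) ppr.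
have -> : x - y = (f - y) - (f - x) by lmodule R.
have := ler_normB (f - y) (f - x); lra.
Qed.

(** Used with b = 2^alpha. The hypotheses allow K to exceed its expected size at the n-th dyadic
    scale by mu^-n; a geometric margin on both sides absorbs this. *)
Lemma Kfun_reiteration r k1 k2 (b : R) : (k2 <= r)%N -> 2 ^+ k1 < b -> b < 2 ^+ k2 ->
  exists mu C : R, [/\ 0 < mu, mu < 1, 0 < C & forall f s Y, 0 < s -> 0 <= Y ->
    (forall n, mu ^+ n * K 0 r ((2 ^+ n * s) ^+ r) f <= b ^+ n * Y) ->
    (forall n, mu ^+ n * K 0 r ((s / 2 ^+ n.+1) ^+ r) f <= Y / b ^+ n.+1) ->
    Er T k1 f /\ s ^+ k1 * K k1 k2 (s ^+ (k2 - k1)) f <= C * Y].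
Proof.
move=> k2r b1 b2.
have k12 : (k1 < k2)%N.
  by have := lt_trans b1 b2; rewrite ltr_eXn2l // ltr1n.
have k1r : (k1 <= r)%N by apply: leq_trans (ltnW k12) k2r.
have p1 : 1 <= 2 ^+ k1 :> R by rewrite exprn_ege1 // ler1n.
have b0 : 1 < b by apply: le_lt_trans b1.
pose mx := Num.max (2 ^+ k1 / b) (b / 2 ^+ k2).
have mx1 : mx < 1.
  by rewrite gt_max !ltr_pdivrMr ?exprn_gt0 // ?mul1r ?b1 ?b2 //; lra.
have mxk1 : 2 ^+ k1 / b <= mx by rewrite le_max lexx.
have mxk2 : b / 2 ^+ k2 <= mx by rewrite le_max lexx orbT.
have mx0 : 0 < mx by apply: lt_le_trans mxk1; rewrite divr_gt0 //; lra.
(* [mx] is the larger ratio of the two series without slack; with [mu] strictly between [mx] and 1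
   the ratios [sg1] and [sg2], enlarged by 1/mu, stay below 1. *)
pose mu := (1 + mx) / 2.
have mumx : mx < mu by rewrite /mu; lra.
have mu0 : 0 < mu by lra.
have mu1 : mu < 1 by rewrite /mu; lra.
clearbody mu mx.
have [C1 C10 H1] := Er_norm_approximants k1r.
have [C2 C20 H2] := Er_norm_approximants k2r.
pose sg1 := 2 ^+ k1 / (b * mu); pose sg2 := b / mu / 2 ^+ k2.
have bp : 0 < b by lra.
have bmu : 0 < b * mu by rewrite mulr_gt0.
have hs1 : 0 <= sg1 < 1.
  rewrite /sg1 divr_ge0 ?exprn_ge0 ?(ltW bmu) //= ltr_pdivrMr // mul1r.
  rewrite mulrC -ltr_pdivrMr //; lra.
have hs2 : 0 <= sg2 < 1.
  rewrite /sg2 !divr_ge0 ?exprn_ge0 ?(ltW bp) ?(ltW mu0) //=.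
  by rewrite mulrAC ltr_pdivrMr // mul1r; lra.
have [/andP[s10 s11] /andP[s20 s21]] := (hs1, hs2).
pose C := 2 * C1 * 4 ^+ k1 / (1 - sg1) + 2 ^+ k1 * (2 * C1) + C2 * (1 + b / mu) / (1 - sg2).
have C0 : 0 < C.
  rewrite /C !addr_gt0 //; rewrite ?divr_gt0 ?mulr_gt0 ?exprn_gt0 //; try lra.
  by rewrite addr_gt0 // divr_gt0.
exists mu, C; split => // f s Y s0 Y0 Hup Hdn.
(* K is an infimum, so near-optimal approximants need strict room above [Y]; [Z] decreases to [Y] at
   the end. *)
have main Z : Y < Z -> Er T k1 f /\ s ^+ k1 * K k1 k2 (s ^+ (k2 - k1)) f <= C * Z.
  move=> YZ; have Z0 : 0 < Z by lra.
  have scale_up n : 0 < 2 ^+ n * s by rewrite mulr_gt0 // exprn_gt0.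
  have scale_dn n : 0 < s / 2 ^+ n by rewrite divr_gt0 // exprn_gt0.
  have exu n : exists h, Er T r h /\
      `|f - h| + (2 ^+ n * s) ^+ r * N r h <= (b / mu) ^+ n * Z.
    have mun : 0 < mu ^+ n by rewrite exprn_gt0.
    have bn : 0 < b ^+ n by rewrite exprn_gt0.
    have pr : 0 <= (2 ^+ n * s) ^+ r by rewrite exprn_ge0 // ltW.
    have Kz : K 0 r ((2 ^+ n * s) ^+ r) f < (b / mu) ^+ n * Z.
      rewrite expr_div_n mulrAC ltr_pdivlMr // mulrC (le_lt_trans (Hup n)) //.
      by rewrite ltr_pM2l.
    have [h [_ Eh Hh]] := Kfun_lt pr (@Er0 _ _ T f) Kz.
    by exists h; split => //; rewrite Er_norm0 in Hh; exact: ltW.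
  (* The hypothesis gives one more factor 1/b; it is dropped here, since b > 1. *)
  have exd n : exists h, Er T r h /\
      `|f - h| + (s / 2 ^+ n.+1) ^+ r * N r h <= (b * mu)^-1 ^+ n * Z.
    have mun : 0 < mu ^+ n by rewrite exprn_gt0.
    have bn : 0 < b ^+ n by rewrite exprn_gt0.
    have pr : 0 <= (s / 2 ^+ n.+1) ^+ r by rewrite exprn_ge0 // ltW.
    have Kz : K 0 r ((s / 2 ^+ n.+1) ^+ r) f < (b * mu)^-1 ^+ n * Z.
      rewrite -(ltr_pM2l mun) (le_lt_trans (Hdn n)) //.
      rewrite exprVn exprMn ltr_pdivrMr ?exprn_gt0 // exprS.
      have -> : mu ^+ n * ((b ^+ n * mu ^+ n)^-1 * Z) * (b * b ^+ n) = b * Z.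
        by field; rewrite !gt_eqF.
      by rewrite (lt_le_trans YZ) // ler_peMl // ltW.
    have [h [_ Eh Hh]] := Kfun_lt pr (@Er0 _ _ T f) Kz.
    by exists h; split => //; rewrite Er_norm0 in Hh; exact: ltW.
  have [u Hu] := choice exu; have [d Hd] := choice exd.
  have Eu n k : (k <= r)%N -> Er T k (u n) by move=> kr; apply: Er_le kr (Hu n).1.
  have Ed n k : (k <= r)%N -> Er T k (d n) by move=> kr; apply: Er_le kr (Hd n).1.
  have bmu1 : (b * mu)^-1 <= 1.
    rewrite invf_le1 // (le_trans p1) // mulrC -ler_pdivrMr //; lra.
  have sk1 : 0 < s ^+ k1 by rewrite exprn_gt0.
  have sk2 : 0 < s ^+ k2 by rewrite exprn_gt0.
  pose a := (b * mu)^-1.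
  have a0 : 0 < a by rewrite invr_gt0.
  have qE n : (s / 2 ^+ n.+2) ^+ k1 = s ^+ k1 / (4 ^+ k1 * (2 ^+ k1) ^+ n).
    rewrite expr_div_n; congr (_ / _).
    by rewrite [in RHS]exprAC -exprMn !exprS; congr (_ ^+ _); ring.
  have Dd n : N k1 (d n.+1 - d n) <= 2 * C1 * 4 ^+ k1 / s ^+ k1 * Z * sg1 ^+ n.
    have q0 : 0 < (s / 2 ^+ n.+2) ^+ k1 by rewrite exprn_gt0.
    have pp : s / 2 ^+ n.+2 <= s / 2 ^+ n.+1.
      by rewrite ler_pM2l // lef_pV2 ?posrE ?exprn_gt0 // ler_eXn2l ?ltr1n.
    have := H1 f _ _ _ _ _ _ (scale_dn n.+2) pp (Hd n.+1).1 (Hd n).1 (Hd n.+1).2 (Hd n).2.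
    rewrite -/a => A; rewrite -(ler_pM2l q0) (le_trans A) //.
    have -> : (s / 2 ^+ n.+2) ^+ k1 * (2 * C1 * 4 ^+ k1 / s ^+ k1 * Z * sg1 ^+ n) =
        2 * C1 * (a ^+ n * Z).
      rewrite qE /sg1 -/a exprMn; field.
      by rewrite !gt_eqF ?exprn_gt0 ?exprn_gt0.
    have an : a ^+ n.+1 * Z <= a ^+ n * Z.
      by rewrite exprS -mulrA ler_piMl // mulr_ge0 ?exprn_ge0 // ltW.
    have := ler_wpM2l (ltW C10) an; lra.
  have Du n : N k2 (u n.+1 - u n) <= C2 * (1 + b / mu) / s ^+ k2 * Z * sg2 ^+ n.
    have q0 : 0 < (2 ^+ n * s) ^+ k2 by rewrite exprn_gt0.
    have pp : 2 ^+ n * s <= 2 ^+ n.+1 * s.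
      by rewrite ler_pM2r // ler_eXn2l ?ltr1n.
    have := H2 f _ _ _ _ _ _ (scale_up n) pp (Hu n).1 (Hu n.+1).1 (Hu n).2 (Hu n.+1).2.
    rewrite (Er_norm_distC hT (Eu n _ k2r) (Eu n.+1 _ k2r)) => A.
    rewrite -(ler_pM2l q0) (le_trans A) //.
    have -> : (2 ^+ n * s) ^+ k2 * (C2 * (1 + b / mu) / s ^+ k2 * Z * sg2 ^+ n) =
        C2 * (1 + b / mu) * ((b / mu) ^+ n * Z).
      rewrite exprMn /sg2 [(b / mu / _) ^+ n]expr_div_n exprAC.
      by field; rewrite !gt_eqF ?exprn_gt0 ?exprn_gt0.
    by rewrite exprS le_eqVlt; apply/orP; left; apply/eqP; ring.
  have Dd0 : 0 <= 2 * C1 * 4 ^+ k1 / s ^+ k1 * Z.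
    by rewrite !mulr_ge0 ?invr_ge0 ?exprn_ge0 // ltW.
  have bm0 : 0 < b / mu by rewrite divr_gt0.
  have Du0 : 0 <= C2 * (1 + b / mu) / s ^+ k2 * Z.
    by rewrite !mulr_ge0 ?invr_ge0 ?exprn_ge0 // ?addr_ge0 // ltW.
  have Gd := Er_norm_geometric hs1 Dd0 (fun n => Ed n _ k1r) Dd.
  have Gu := Er_norm_geometric hs2 Du0 (fun n => Eu n _ k2r) Du.
  have ha : 0 <= a < 1.
    rewrite ltW //= /a invf_lt1 // (le_lt_trans p1) // mulrC -ltr_pdivrMr //; lra.
  have cvd : d @ \oo --> f.
    apply/cvgrPdist_le => e e0.
    have [n0 Hn0] := expr_lt_eventually ha (divr_gt0 e0 Z0).
    exists n0 => // n /= /Hn0; rewrite ltr_pdivlMr // => an.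
    rewrite (le_trans _ (ltW an)) // (le_trans _ (Hd n).2) // lerDl.
    by rewrite mulr_ge0 ?Er_norm_ge0 // exprn_ge0 // ltW.
  have s1p : 0 < 1 - sg1 by lra.
  have s2p : 0 < 1 - sg2 by lra.
  have [Ef cvN] : Er T k1 f /\ (forall e : R, 0 < e -> exists n0, forall n, (n0 <= n)%N ->
      N k1 (f - d n) <= e).
    apply: (Er_complete hT cvd (fun n => Ed n _ k1r)) => e e0.
    have De : 0 < e * (1 - sg1) / (2 * C1 * 4 ^+ k1 / s ^+ k1 * Z + 1).
      by rewrite divr_gt0 ?mulr_gt0 //; lra.
    have [n0 Hn0] := expr_lt_eventually hs1 De.
    have half m n : (n0 <= n)%N -> (n <= m)%N -> N k1 (d m - d n) <= e.
      move=> hn nm; rewrite -(subnKC nm) (le_trans (Gd _ _)) // ler_pdivrMr //.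
      have := Hn0 n hn; rewrite ltr_pdivlMr; last lra.
      have := exprn_ge0 n s10; lra.
    exists n0 => m n hm hn; have [mn|/ltnW nm] := leqP m n; last exact: half.
    by rewrite (Er_norm_distC hT (Ed m _ k1r) (Ed n _ k1r)); exact: half.
  split => //.
  have Nd : N k1 (f - d 0%N) <= 2 * C1 * 4 ^+ k1 / s ^+ k1 * Z / (1 - sg1).
    apply/ler_addgt0Pr => e e0; have [n0 /(_ n0 (leqnn n0)) Hn0] := cvN e e0.
    have -> : f - d 0%N = (d (0 + n0)%N - d 0%N) + (f - d n0) by rewrite add0n; lmodule R.
    have G0 := Gd 0%N n0; rewrite expr0 mulr1 in G0.
    have [E0 E1] := ((ErB hT (Ed n0 _ k1r) (Ed 0%N _ k1r)).1, (ErB hT Ef (Ed n0 _ k1r)).1).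
    rewrite add0n in G0 *; rewrite (le_trans (ErD hT E0 E1).2) //.
    by rewrite lerD.
  (* [u 0] is a telescoping sum up to the tail [u m], and k2 <= r makes N_r (u m), hence N_k2 (u m),
     at most sg2^m Z/s^r, which tends to 0. *)
  have Nu : N k2 (u 0%N) <= C2 * (1 + b / mu) / s ^+ k2 * Z / (1 - sg2).
    apply: (le_of_geometric hs2 (z := Z / s ^+ r)) => [|m].
      by rewrite divr_ge0 ?exprn_ge0 // ltW.
    have -> : u 0%N = - (u (0 + m)%N - u 0%N) + u m by rewrite add0n; lmodule R.
    have G0 := Gu 0%N m; rewrite expr0 mulr1 in G0.
    have [E0 N0] := ErZ hT (-1) (ErB hT (Eu (0 + m)%N _ k2r) (Eu 0%N _ k2r)).1.
    rewrite normrN1 mul1r in N0; rewrite scaleN1r in E0 N0.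
    rewrite (le_trans (ErD hT E0 (Eu m _ k2r)).2) // lerD // ?N0 //.
    rewrite (le_trans (Er_norm_le T _ k2r)) //.
    have q0 : 0 < (2 ^+ m * s) ^+ r by rewrite exprn_gt0.
    rewrite -(ler_pM2l q0).
    have := (Hu m).2; have := normr_ge0 (f - u m) => nn A.
    apply: (@le_trans _ _ ((b / mu) ^+ m * Z)); first lra.
    have -> : (2 ^+ m * s) ^+ r * (sg2 ^+ m * (Z / s ^+ r)) =
        (b / mu) ^+ m * Z * ((2 ^+ r) ^+ m / (2 ^+ k2) ^+ m).
      rewrite exprMn /sg2 [(b / mu / _) ^+ m]expr_div_n [(2 ^+ m) ^+ r]exprAC.
      by field; rewrite !gt_eqF ?exprn_gt0 ?exprn_gt0.
    rewrite ler_peMr //; first by rewrite mulr_ge0 ?exprn_ge0 // ltW.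
    by rewrite -expr_div_n exprn_ege1 // ler_pdivlMr ?exprn_gt0 // mul1r ler_eXn2l ?ltr1n.
  (* The link between the two sequences: [d 0] lives at scale s/2 and [u 0] at scale [s]. *)
  have Nm : (s / 2) ^+ k1 * N k1 (d 0%N - u 0%N) <= C1 * (Z + Z).
    have pp : s / 2 ^+ 1 <= 2 ^+ 0 * s by rewrite expr0 expr1 mul1r; lra.
    have := H1 f _ _ _ _ _ _ (scale_dn 1%N) pp (Hd 0%N).1 (Hu 0%N).1 (Hd 0%N).2 (Hu 0%N).2.
    by rewrite !expr0 expr1 !mul1r.
  have -> : f = (f - u 0%N) + u 0%N by rewrite subrK.
  have [Efu _] := ErB hT Ef (Eu 0%N _ k1r).
  have sd : 0 <= s ^+ (k2 - k1) by rewrite exprn_ge0 // ltW.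
  rewrite (le_trans (ler_wpM2l (ltW sk1) (Kfun_le sd Efu (Eu 0%N _ k2r)))) //.
  have -> : s ^+ k1 * (N k1 (f - u 0%N) + s ^+ (k2 - k1) * N k2 (u 0%N)) =
     s ^+ k1 * N k1 (f - u 0%N) + s ^+ k2 * N k2 (u 0%N).
    by rewrite mulrDr mulrA -exprD subnKC // ltnW.
  have N1 : N k1 (f - u 0%N) <= N k1 (f - d 0%N) + N k1 (d 0%N - u 0%N).
    have -> : f - u 0%N = (f - d 0%N) + (d 0%N - u 0%N) by rewrite addrA subrK.
    exact: (ErD hT (ErB hT Ef (Ed 0%N _ k1r)).1 (ErB hT (Ed 0%N _ k1r) (Eu 0%N _ k1r)).1).2.
  have B1 := ler_wpM2l (ltW sk1) Nd.
  have B2 := ler_wpM2l (ltW sk2) Nu.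
  have B3 : s ^+ k1 * N k1 (d 0%N - u 0%N) <= 2 ^+ k1 * (2 * C1) * Z.
    have t1 : 0 <= 2 ^+ k1 :> R by rewrite exprn_ge0.
    have sE : s ^+ k1 = 2 ^+ k1 * (s / 2) ^+ k1.
      by rewrite -exprMn [2 * _]mulrC divfK.
    have := ler_wpM2l t1 Nm; rewrite sE; lra.
  have B4 := ler_wpM2l (ltW sk1) N1.
  have e1 : s ^+ k1 * (2 * C1 * 4 ^+ k1 / s ^+ k1 * Z / (1 - sg1)) =
      2 * C1 * 4 ^+ k1 / (1 - sg1) * Z.
    by field; rewrite !gt_eqF.
  have e2 : s ^+ k2 * (C2 * (1 + b / mu) / s ^+ k2 * Z / (1 - sg2)) =
      C2 * (1 + b / mu) / (1 - sg2) * Z.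
    by field; rewrite !gt_eqF.
  rewrite e1 in B1; rewrite e2 in B2.
  rewrite /C; lra.
have Y1 : Y < Y + 1 by lra.
split; first exact: (main _ Y1).1.
apply/ler_addgt0Pr => e e0.
have Ye : Y < Y + e / C by rewrite ltrDl divr_gt0.
have := (main _ Ye).2; rewrite mulrDr [C * (e / C)]mulrC divfK ?gt_eqF //.
Qed.

End KFunctional.

(** * Integration against dt/t *)

Section HaarIntegral.
Context (R : realType).
Notation mu := (@lebesgue_measure R).

(** The class of functions integrated against dt/t; it provides measurability and the change of
    variables, and asks for nothing outside (0, oo). *)
Definition cont_nneg (g : R -> R) : Prop :=
  forall t, 0 < t -> 0 <= g t /\ {for t, continuous g}.

Lemma cont_nneg_ge0 g t : cont_nneg g -> 0 < t -> 0 <= g t.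
Proof. by move=> H /H[]. Qed.

Lemma cont_nneg_monomial g (c : R) n : 0 < c -> cont_nneg g ->
  cont_nneg (fun s => g (c * s ^+ n)).
Proof.
move=> c0 H t t0; have ct : 0 < c * t ^+ n by rewrite mulr_gt0 // exprn_gt0.
have [g0 cg] := H _ ct; split => //.
apply: (@continuous_comp _ _ _ (fun s : R => c * s ^+ n) g) => //.
by apply: cvgM; [exact: cvg_cst | exact: exprn_continuous].
Qed.

Lemma cont_nneg_powR g (q : R) : 0 < q -> cont_nneg g -> cont_nneg (fun t => g t `^ q).
Proof.
move=> q0 H t t0; have [g0 cg] := H t t0; split; first exact: powR_ge0.
move: g0; rewrite le_eqVlt => /predU1P[g0|gp]; last first.
  apply: (@continuous_comp _ _ _ g (fun x => x `^ q)) => //.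
  apply: differentiable_continuous; apply/derivable1_diffP.
  by have D := is_derive1_powR q gp; exact: ex_derive.
(* At a zero of [g] the power need not be differentiable, so continuity is checked by hand. *)
apply/cvgrPdist_le => e e0 /=; rewrite -g0 powR0 ?gt_eqF //.
have e1 : 0 < e `^ q^-1 by rewrite powR_gt0.
have : \forall x \near t, `|g t - g x| <= e `^ q^-1.
  by move/cvgrPdist_le : cg; apply.
move=> A; near=> x.
have x0 : 0 < x.
  have : `|t - x| < t by near: x; apply: cvgr_dist_lt.
  by rewrite ltr_norml => /andP[_]; lra.
have : `|g t - g x| <= e `^ q^-1 by near: x.
rewrite -g0 !sub0r !normrN !ger0_norm ?powR_ge0 ?(H x x0).1 // => gx.
have := @ge0_ler_powR _ q (ltW q0) (g x) (e `^ q^-1).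
rewrite !nnegrE powR_ge0 (H x x0).1 => /(_ isT isT gx).
by rewrite -powRrM mulVf ?gt_eqF // powRr1 // ltW.
Unshelve. all: by end_near. Qed.

Lemma measurable_haar g : cont_nneg g ->
  measurable_fun (`]0, +oo[%classic : set R) (fun t => (g t / t)%:E).
Proof.
move=> H; apply/measurable_EFinP; apply: open_continuous_measurable_fun.
  exact: interval_open.
move=> t; rewrite inE /= in_itv /= andbT => t0.
by apply: cvgM; [exact: (H t t0).2 | apply: cvgV; [rewrite gt_eqF | exact: cvg_id]].
Qed.

Lemma haar_ge0 g t : cont_nneg g -> `]0, +oo[%classic t -> (0 <= (g t / t)%:E :> \bar R)%E.
Proof.
move=> H; rewrite /= in_itv /= andbT => t0.
by rewrite lee_fin divr_ge0 ?(cont_nneg_ge0 H) // ltW.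
Qed.

(** Under t = c s^(n+1) one has dt/t = (n+1) ds/s. The substitution is made on compact intervals and
    extended to (0, oo) by monotone convergence. *)
Lemma haar_integral_monomial phi (c : R) n : 0 < c -> cont_nneg phi ->
  (\int[mu]_(s in `]0%R, +oo[) (phi (c * s ^+ n.+1) / s)%:E =
   (n.+1%:R^-1)%:E * \int[mu]_(t in `]0%R, +oo[) (phi t / t)%:E)%E.
Proof.
move=> c0 H.
pose F (s : R) := c * s ^+ n.+1; pose G t := phi t / t.
have HF : cont_nneg (fun s => phi (F s)) by exact: cont_nneg_monomial.
have F0 s : 0 < s -> 0 < F s by move=> s0; rewrite mulr_gt0 // exprn_gt0.
have dF (s : R) : is_derive s 1 F (c * (n.+1%:R * s ^+ n)).
  have -> : F = c *: ((@id R) ^+ n.+1) by apply/funext => x; rewrite exprfctE.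
  by apply: is_derive_eq; rewrite /= /GRing.scale /= mulr1.
have DF : F^`()%classic = fun s => c * (n.+1%:R * s ^+ n).
  by apply/funext => s; rewrite derive1E (@derive_val _ _ _ _ _ _ _ (dF s)).
have cDF : continuous (F^`()%classic).
  rewrite DF => s; apply: cvgM; first exact: cvg_cst.
  by apply: cvgM; [exact: cvg_cst | exact: exprn_continuous].
have cF : continuous F.
  by move=> s; apply: cvgM; [exact: cvg_cst | exact: exprn_continuous].
(* With a < 1 < b, raising to the power n+1 only widens the interval, so the images under [F]
   exhaust (0, oo) too. *)
pose a (i : nat) : R := i.+2%:R^-1; pose b (i : nat) : R := i.+2%:R.
have a0 i : 0 < a i by rewrite invr_gt0.
have b0 i : 1 < b i by rewrite ltr1n.
have ab i : a i <= b i by rewrite (@le_trans _ _ 1) ?invf_le1 ?(ltW (b0 i)) // ltW // ltr0n.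
have cG t : 0 < t -> {for t, continuous G}.
  move=> t0; apply: cvgM; first exact: (H t t0).2.
  by apply: cvgV; [rewrite gt_eqF | exact: cvg_id].
have Fhomo : {in `]0, +oo[ &, {homo F : x y / x < y}}.
  move=> x y; rewrite !in_itv /= !andbT => x0 y0 xy.
  by rewrite ltr_pM2l // ltr_pXn2r // nnegrE ltW.
have bnd i : (\int[mu]_(t in `[F (a i), F (b i)]) (G t)%:E =
    n.+1%:R%:E * \int[mu]_(s in `[a i, b i]) (phi (F s) / s)%:E)%E.
  rewrite integration_by_substitution_increasing //; first last.
  - apply: continuous_in_subspaceT => t; rewrite inE /= in_itv /= => /andP[Ft _].
    by apply: cG; apply: lt_le_trans Ft; exact: F0.
  - split.
    + by move=> x _; have D := dF x; exact: ex_derive.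
    + by apply: cvg_at_right_filter; exact: cF.
    + by apply: cvg_at_left_filter; exact: cF.
  - by apply/cvg_ex; eexists; apply: cvg_at_left_filter; exact: cDF.
  - by apply/cvg_ex; eexists; apply: cvg_at_right_filter; exact: cDF.
  - move=> x y; rewrite !in_itv /= => /andP[ax _] /andP[ay _]; apply: Fhomo.
      by rewrite in_itv /= andbT (lt_le_trans _ ax).
    by rewrite in_itv /= andbT (lt_le_trans _ ay).
  have sub : `[a i, b i] `<=` `]0, +oo[%classic.
    by move=> x; rewrite /= !in_itv /= andbT => /andP[ax _]; apply: lt_le_trans ax.
  rewrite -ge0_integralZl_EFin //; first last.
  - exact: (measurable_funS (measurable_itv _) sub (measurable_haar HF)).
  - by move=> x /sub; exact: (haar_ge0 HF).
  apply: eq_integral => x; rewrite inE => /sub; rewrite /= in_itv /= andbT => x0.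
  rewrite -EFinM DF; congr EFin.
  change (phi (F x) / F x * (c * (n.+1%:R * x ^+ n)) = n.+1%:R * (phi (F x) / x)).
  move: (phi (F x)) => y; rewrite /F exprS; field.
  by rewrite !gt_eqF ?exprn_gt0.
have le_ab i j : (i <= j)%N -> a j <= a i /\ b i <= b j.
  by move=> ij; rewrite /a lef_pV2 ?posrE ?ltr0n // /b !ler_nat !ltnS.
have big x : 0 < x -> exists i, a i <= x <= b i.
  move=> x0; exists (Num.truncn (x + x^-1)); rewrite /a /b.
  have := truncnS_gt (x + x^-1); rewrite -natr1 => h.
  have xi : 0 < x^-1 by rewrite invr_gt0.
  have n2 : (Num.truncn (x + x^-1)).+2%:R = (Num.truncn (x + x^-1)).+1%:R + 1 :> R by rewrite natr1.
  apply/andP; split; last by rewrite n2 -natr1; lra.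
  by rewrite -[leRHS]invrK lef_pV2 ?posrE ?ltr0n // n2 -natr1; lra.
have U1 : \bigcup_i `[F (a i), F (b i)]%classic = `]0, +oo[%classic :> set R.
  apply/seteqP; split => x /=.
    by move=> [i _]; rewrite /= !in_itv /= andbT => /andP[ax _]; apply: lt_le_trans ax; exact: F0.
  rewrite in_itv /= andbT => x0.
  have [j /andP[j1 j2]] := big _ x0.
  have [i /andP[i1 i2]] := big _ (divr_gt0 x0 c0).
  have ai : a i ^+ n.+1 <= x / c.
    have a1 : a i <= 1 by rewrite invf_le1 ?ltr0n // ler1n.
    by rewrite (le_trans _ i1) // exprS ler_piMr ?(ltW (a0 i)) // exprn_ile1 // ltW.
  have bi : x / c <= b i ^+ n.+1.
    by rewrite (le_trans i2) // exprS ler_peMr ?exprn_ege1 ?(ltW (b0 i)).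
  rewrite ler_pdivlMr // mulrC in ai; rewrite ler_pdivrMr // mulrC in bi.
  by exists i => //=; rewrite in_itv /= /F ai.
have U2 : \bigcup_i `[a i, b i]%classic = `]0, +oo[%classic :> set R.
  apply/seteqP; split => x /=.
    by move=> [i _]; rewrite /= !in_itv /= andbT => /andP[ax _]; apply: lt_le_trans ax.
  by rewrite in_itv /= andbT => /big[i hi]; exists i => //=; rewrite in_itv.
have C1 : (\int[mu]_(t in `[F (a i), F (b i)]) (G t)%:E @[i --> \oo] -->
    \int[mu]_(t in `]0%R, +oo[) (G t)%:E)%E.
  rewrite -U1; apply: ge0_nondecreasing_set_cvg_integral => //.
  - move=> i j ij; have [aij bij] := le_ab _ _ ij; rewrite subsetEset => x /=.
    rewrite !in_itv /= => /andP[x1 x2]; rewrite (le_trans _ x1) ?(le_trans x2) //.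
      by rewrite ler_pM2l // lerXn2r // nnegrE (le_trans ler01) // ltW.
    by rewrite ler_pM2l // lerXn2r // nnegrE ltW.
  - move=> i; apply: (measurable_funS _ _ (measurable_haar H)); first exact: measurable_itv.
    by move=> x; rewrite -U1; exists i.
  - by move=> i x hx; apply: haar_ge0 => //; rewrite -U1; exists i.
have C2 : (\int[mu]_(t in `[a i, b i]) (phi (F t) / t)%:E @[i --> \oo] -->
    \int[mu]_(t in `]0%R, +oo[) (phi (F t) / t)%:E)%E.
  rewrite -U2; apply: ge0_nondecreasing_set_cvg_integral => //.
  - move=> i j ij; have [aij bij] := le_ab _ _ ij; rewrite subsetEset => x /=.
    by rewrite !in_itv /= => /andP[x1 x2]; rewrite (le_trans _ x1) ?(le_trans x2).
  - move=> i; apply: (measurable_funS _ _ (measurable_haar HF)); first exact: measurable_itv.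
    by move=> x; rewrite -U2; exists i.
  - by move=> i x hx; apply: (haar_ge0 HF) => //; rewrite -U2; exists i.
have := cvgeZl (y := n.+1%:R%:E) isT C2.
under eq_fun do rewrite -bnd.
move=> C3; have -> := cvg_unique _ C1 C3.
  by rewrite muleA -EFinM mulVf ?mul1e.
exact: ereal_hausdorff.
Qed.

End HaarIntegral.

(** * Norms of L^q type with respect to dt/t *)

Section WeightedNorm.
Context (R : realType).
Notation mu := (@lebesgue_measure R).

(** [interp_norm] is by conversion this norm of the weighted K-functional. *)
Definition lq_norm (q : \bar R) (g : R -> R) : \bar R :=
  match q with
  | +oo%E => ereal_sup [set (g t)%:E | t in `]0, +oo[%classic]
  | (q'%:E)%E => poweR (\int[mu]_(t in `]0, +oo[%classic) ((g t `^ q') / t)%:E) q'^-1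
  | -oo%E => +oo%E
  end.

Lemma lq_norm_eq (q : \bar R) (g h : R -> R) : (forall t, 0 < t -> g t = h t) ->
  lq_norm q g = lq_norm q h.
Proof.
move=> gh; case: q => [q||]; last by [].
  rewrite /lq_norm; congr poweR; apply: eq_integral => t.
  by rewrite inE /= in_itv /= andbT => /gh ->.
rewrite /lq_norm; congr ereal_sup; apply/seteqP; split=> x [t t0 <-]; exists t => //;
  by move: t0; rewrite /= in_itv /= andbT => /gh ->.
Qed.

Lemma cont_nneg_eq (g h : R -> R) : (forall t, 0 < t -> g t = h t) ->
  cont_nneg g -> cont_nneg h.
Proof.
move=> gh Hg t t0; have [g0 cg] := Hg t t0; split; first by rewrite -gh.
apply/cvgrPdist_le => e e0.
have cge : \forall x \near t, `|g t - g x| <= e by move/cvgrPdist_le: cg; apply.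
near=> x; have x0 : 0 < x.
  have : `|t - x| < t by near: x; apply: cvgr_dist_lt.
  by rewrite ltr_norml => /andP[_]; lra.
by rewrite -!gh //; near: x.
Unshelve. all: by end_near. Qed.

Lemma cont_nneg_scale g (c : R) : 0 < c -> cont_nneg g -> cont_nneg (fun s => g (c * s)).
Proof. by move=> c0 /(@cont_nneg_monomial _ _ _ 1 c0). Qed.

Lemma cont_nnegD (g h : R -> R) : cont_nneg g -> cont_nneg h -> cont_nneg (fun s => g s + h s).
Proof.
move=> Hg Hh t t0; have [g0 cg] := Hg t t0; have [h0 ch] := Hh t t0.
by split; [rewrite addr_ge0 | apply: cvgD].
Qed.

Lemma cont_nnegZ (c : R) (g : R -> R) : 0 <= c -> cont_nneg g -> cont_nneg (fun s => c * g s).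
Proof.
move=> c0 Hg t t0; have [g0 cg] := Hg t t0.
by split; [rewrite mulr_ge0 | apply: cvgM => //; exact: cvg_cst].
Qed.

Lemma haar_integral_scale phi (c : R) : 0 < c -> cont_nneg phi ->
  (\int[mu]_(s in `]0%R, +oo[) (phi (c * s) / s)%:E =
   \int[mu]_(t in `]0%R, +oo[) (phi t / t)%:E)%E.
Proof.
move=> c0 H; have := haar_integral_monomial 0 c0 H.
by rewrite invr1 mul1e => <-; apply: eq_integral => s _; rewrite expr1.
Qed.

Lemma haar_integralD g h : cont_nneg g -> cont_nneg h ->
  (\int[mu]_(s in `]0%R, +oo[) ((g s + h s) / s)%:E =
   \int[mu]_(s in `]0%R, +oo[) (g s / s)%:E + \int[mu]_(s in `]0%R, +oo[) (h s / s)%:E)%E.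
Proof.
move=> Hg Hh; rewrite -ge0_integralD //.
- by apply: eq_integral => s _; rewrite -EFinD mulrDl.
- by move=> t; exact: haar_ge0.
- exact: measurable_haar.
- by move=> t; exact: haar_ge0.
- exact: measurable_haar.
Qed.

Lemma haar_integralZ (c : R) g : 0 <= c -> cont_nneg g ->
  (\int[mu]_(s in `]0%R, +oo[) (c * g s / s)%:E =
   c%:E * \int[mu]_(s in `]0%R, +oo[) (g s / s)%:E)%E.
Proof.
move=> c0 Hg; rewrite -ge0_integralZl_EFin //.
- by apply: eq_integral => s _; rewrite -EFinM mulrA.
- by move=> t; exact: haar_ge0.
- exact: measurable_haar.
Qed.

Lemma haar_integral_ge0 g : cont_nneg g ->
  (0 <= \int[mu]_(t in `]0%R, +oo[) (g t / t)%:E)%E.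
Proof. by move=> H; apply: integral_ge0 => t; exact: haar_ge0. Qed.

Lemma powR_invK (x q : R) : 0 < q -> 0 <= x -> (x `^ q) `^ q^-1 = x.
Proof. by move=> q0 x0; rewrite -powRrM divff ?gt_eqF // powRr1. Qed.

Lemma powR_Kinv (x q : R) : 0 < q -> 0 <= x -> (x `^ q^-1) `^ q = x.
Proof. by move=> q0 x0; rewrite -powRrM mulVf ?gt_eqF // powRr1. Qed.

Lemma poweR_le (q D : R) (x y : \bar R) : 0 < q -> 0 <= D -> (0 <= x)%E -> (0 <= y)%E ->
  (x <= D%:E * y)%E -> (poweR x q^-1 <= (D `^ q^-1)%:E * poweR y q^-1)%E.
Proof.
move=> q0 D0 x0 y0 xy; rewrite -poweR_EFin -poweRM ?lee_fin //.
apply: gt0_ler_poweR => //; first by rewrite invr_ge0 ltW.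
  by rewrite in_itv /= x0 leey.
by rewrite in_itv /= leey andbT mule_ge0 ?lee_fin.
Qed.

Lemma lq_norm_le (q : \bar R) (C : R) g1 g2 : (1 <= q)%E -> 0 <= C ->
  cont_nneg g1 -> cont_nneg g2 -> (forall t, 0 < t -> g1 t <= C * g2 t) ->
  (lq_norm q g1 <= C%:E * lq_norm q g2)%E.
Proof.
case: q => [q||] //=; last first.
  move=> _ C0 H1 H2 H; apply: ge_ereal_sup => _ /= [t + <-].
  rewrite in_itv /= andbT => t0.
  apply: (@le_trans _ _ (C%:E * (g2 t)%:E)%E); first by rewrite -EFinM lee_fin H.
  rewrite lee_wpmul2l ?lee_fin //; apply: ereal_sup_ubound.
  by exists t => //=; rewrite in_itv /= andbT.
rewrite lee_fin => q1 C0 H1 H2 H; have q0 : 0 < q by lra.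
have P1 := cont_nneg_powR q0 H1; have P2 := cont_nneg_powR q0 H2.
rewrite -[X in (X%:E * _)%E](powR_invK q0 C0); apply: poweR_le => //; try exact: haar_integral_ge0.
  exact: powR_ge0.
rewrite -ge0_integralZl_EFin ?powR_ge0 //; first last.
- exact: (measurable_haar P2).
- by move=> t; exact: (haar_ge0 P2).
apply: ge0_le_integral => //.
- by move=> t; exact: (haar_ge0 P1).
- exact: (measurable_haar P1).
- by apply: measurable_funeM; exact: (measurable_haar P2).
move=> t; rewrite /= in_itv /= andbT => t0; rewrite -EFinM lee_fin mulrA.
have g20 := cont_nneg_ge0 H2 t0; have g10 := cont_nneg_ge0 H1 t0.
rewrite ler_wpM2r ?invr_ge0 ?(ltW t0) // -powRM //.
by apply: ge0_ler_powR; rewrite ?nnegrE ?mulr_ge0 ?(ltW q0) // H.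
Qed.

Lemma lq_norm_expr (q : \bar R) n : (1 <= q)%E -> exists2 a : R, 0 < a & forall g,
  cont_nneg g -> lq_norm q (fun s => g (s ^+ n.+1)) = (a%:E * lq_norm q g)%E.
Proof.
case: q => [q||] //=; last first.
  move=> _; exists 1 => // g H; rewrite mul1e; congr ereal_sup; apply/seteqP; split => x /=.
    move=> [t + <-]; rewrite in_itv /= andbT => t0.
    by exists (t ^+ n.+1) => //; rewrite in_itv /= andbT exprn_gt0.
  move=> [t + <-]; rewrite in_itv /= andbT => t0.
  exists (t `^ n.+1%:R^-1); first by rewrite in_itv /= andbT powR_gt0.
  by rewrite -powR_mulrn ?powR_ge0 // powR_Kinv ?ltr0n // ltW.
rewrite lee_fin => q1; have q0 : 0 < q by lra.
exists ((n.+1%:R^-1) `^ q^-1) => [|g H]; first by rewrite powR_gt0 // invr_gt0.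
have P := cont_nneg_powR q0 H.
rewrite -poweR_EFin -poweRM ?lee_fin ?invr_ge0 ?(haar_integral_ge0 P) //; congr poweR.
rewrite -(haar_integral_monomial n ltr01 P).
by apply: eq_integral => s _; rewrite mul1r.
Qed.

Lemma sume_geometric_le (rho : R) (X : \bar R) : 0 <= rho < 1 -> (0 <= X)%E ->
  (\sum_(0 <= n <oo) (rho ^+ n)%:E * X <= ((1 - rho)^-1)%:E * X)%E.
Proof.
move=> /andP[r0 r1] X0; have r2 : 0 < 1 - rho by lra.
apply: lime_le.
  by apply: is_cvg_nneseries => n _ _; rewrite mule_ge0 // lee_fin exprn_ge0.
apply: nearW => n; apply: (@le_trans _ _ (((1 - rho ^+ n) / (1 - rho))%:E * X)%E).
  elim: n => [|n IHn]; first by rewrite big_geq // expr0 subrr mul0r mul0e.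
  rewrite big_nat_recr //= (le_trans (leeD2r _ IHn)) //.
  have rn1 : rho ^+ n <= 1 by rewrite exprn_ile1 // ltW.
  rewrite -ge0_muleDl ?lee_fin ?exprn_ge0 ?divr_ge0 ?(ltW r2) ?subr_ge0 //.
  rewrite le_eqVlt; apply/orP; left; apply/eqP; congr (_ * _)%E.
  by rewrite -EFinD; congr EFin; rewrite exprS; field; rewrite gt_eqF.
rewrite lee_wpmul2r // lee_fin ler_pdivrMr // mulVf ?gt_eqF //.
by rewrite gerBl exprn_ge0.
Qed.

(* Instead of Minkowski's inequality for a geometric sum of dilates, the
   hypothesis asks for a bound by any majorant Y of the weighted dilates; the
   l^q sum of the weighted dilates is such a majorant. *)
Lemma lq_norm_dilates (q : \bar R) (m C : R) : (1 <= q)%E -> 0 < m < 1 -> 0 < C ->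
  exists2 C' : R, 0 < C' & forall kap ell, cont_nneg kap -> cont_nneg ell ->
    (forall s Y, 0 < s -> 0 <= Y -> (forall n, m ^+ n * kap (2 ^+ n * s) <= Y) ->
       (forall n, m ^+ n * kap ((2 ^+ n.+1)^-1 * s) <= Y) -> ell s <= C * Y) ->
    (lq_norm q ell <= C'%:E * lq_norm q kap)%E.
Proof.
move=> q1 /andP[m0 m1] C0; case: q q1 => [q||] //=; last first.
  move=> _; exists C => // kap ell Hk He H; apply: ge_ereal_sup => _ /= [s + <-].
  rewrite in_itv /= andbT => s0; set S := ereal_sup _.
  have ub t : 0 < t -> ((kap t)%:E <= S)%E.
    by move=> t0; apply: ereal_sup_ubound; exists t => //=; rewrite in_itv /= andbT.
  have S0 : (0 <= S)%E.
    by apply: le_trans (ub 1 ltr01); rewrite lee_fin (cont_nneg_ge0 Hk).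
  case: S S0 ub => [r||] //.
    rewrite lee_fin => r0 ub; rewrite -EFinM lee_fin.
    have Kr n t : 0 < t -> m ^+ n * kap t <= r.
      move=> t0; have := ub t t0; rewrite lee_fin => kr.
      rewrite (le_trans _ kr) // ler_piMl ?(cont_nneg_ge0 Hk) //.
      by rewrite exprn_ile1 // ltW.
    by apply: H => // n; apply: Kr; rewrite mulr_gt0 ?invr_gt0 ?exprn_gt0.
  by move=> _ _; rewrite gt0_muley ?lte_fin // leey.
rewrite lee_fin => q1; have q0 : 0 < q by lra.
pose rho := m `^ q.
have r0 : 0 < rho by rewrite powR_gt0.
have r1 : rho < 1.
  have -> : 1 = 1 `^ q :> R by rewrite powR1.
  by apply: gt0_ltr_powR; rewrite ?nnegrE // ltW.
have r2 : 0 < 1 - rho by lra.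
have Cq : 0 < C `^ q by rewrite powR_gt0.
exists ((C `^ q * ((1 - rho)^-1 * 2)) `^ q^-1).
  by rewrite powR_gt0 // !mulr_gt0 // invr_gt0.
move=> kap ell Hk He H.
have Pk := cont_nneg_powR q0 Hk; have Pe := cont_nneg_powR q0 He.
apply: poweR_le => //; try exact: haar_integral_ge0.
  by rewrite !mulr_ge0 ?invr_ge0 // ltW.
set J := (\int[mu]_(t in `]0%R, +oo[) (kap t `^ q / t)%:E)%E.
have J0 : (0 <= J)%E by exact: haar_integral_ge0.
have p2 n : 0 < 2 ^+ n :> R by rewrite exprn_gt0.
have p2V n : 0 < (2 ^+ n.+1)^-1 :> R by rewrite invr_gt0.
(* One upward and one downward dilate for each [n]; by dilation invariance each has integral [J]. *)
pose f n s := kap (2 ^+ n * s) `^ q + kap ((2 ^+ n.+1)^-1 * s) `^ q.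
have f1 n := cont_nneg_scale (p2 n) Pk.
have f2 n := cont_nneg_scale (p2V n) Pk.
have Hf n : cont_nneg (f n) by apply: cont_nnegD; [exact: f1 | exact: f2].
have rn n : 0 <= rho ^+ n by rewrite exprn_ge0 // ltW.
have Hrf n : cont_nneg (fun s => rho ^+ n * f n s) by apply: cont_nnegZ.
pose F n s := (rho ^+ n * f n s / s)%:E.
have mF n : measurable_fun (`]0, +oo[%classic : set R) (F n) by exact: (measurable_haar (Hrf n)).
have F0 n s : (`]0, +oo[%classic : set R) s -> (0 <= F n s)%E by exact: (haar_ge0 (Hrf n)).
have intF n : (\int[mu]_(s in `]0%R, +oo[) F n s = (rho ^+ n)%:E * (2%:E * J))%E.
  have -> : (2%:E * J = J + J)%E by rewrite (_ : 2 = 1 + 1) // EFinD ge0_muleDl ?lee_fin // mul1e.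
  rewrite (haar_integralZ (rn n) (Hf n)) (haar_integralD (f1 n) (f2 n)).
  by rewrite (haar_integral_scale (p2 n) Pk) (haar_integral_scale (p2V n) Pk).
have sum0 s : (`]0, +oo[%classic : set R) s -> (0 <= \sum_(0 <= n <oo) F n s)%E.
  by move=> hs; apply: nneseries_ge0 => n _ _; exact: F0.
have mS : measurable_fun (`]0, +oo[%classic : set R) (fun s => \sum_(0 <= n <oo) F n s)%E.
  by apply: ge0_emeasurable_sum => // n s hs _; exact: F0.
apply: (@le_trans _ _ (\int[mu]_(s in `]0%R, +oo[) ((C `^ q)%:E * \sum_(0 <= n <oo) F n s))%E).
  apply: ge0_le_integral => //.
  - by move=> t; exact: (haar_ge0 Pe).
  - exact: (measurable_haar Pe).
  - exact: measurable_funeM.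
  move=> s hs; have s0 : 0 < s by move: hs; rewrite /= in_itv /= andbT.
  have FS n : (F n s <= \sum_(0 <= n <oo) F n s)%E.
    apply: le_trans (nneseries_lim_ge n.+1 (fun k _ _ => F0 k s hs)).
    by rewrite big_nat_recr //= leeDr // sume_ge0 // => i _; exact: F0.
  have := sum0 s hs; case: (\sum_(0 <= n <oo) F n s)%E FS => [y||] // FS; last first.
    by move=> _; rewrite gt0_muley ?lte_fin // leey.
  rewrite lee_fin => y0; rewrite -EFinM lee_fin ler_pdivrMr //.
  have ys0 : 0 <= y * s by rewrite mulr_ge0 // ltW.
  have key n t : 0 < t -> rho ^+ n * kap t `^ q <= y * s -> m ^+ n * kap t <= (y * s) `^ q^-1.
    move=> t0; have mk : 0 <= m ^+ n * kap t.
      by rewrite mulr_ge0 ?(cont_nneg_ge0 Hk) // exprn_ge0 // ltW.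
    have -> : rho ^+ n = (m ^+ n) `^ q.
      by rewrite /rho -powR_mulrn ?powR_ge0 // -powRrM mulrC powRrM powR_mulrn ?(ltW m0).
    rewrite -powRM ?(cont_nneg_ge0 Hk) ?exprn_ge0 ?(ltW m0) // => hh.
    rewrite -(powR_invK q0 mk); apply: ge0_ler_powR => //;
      by rewrite ?nnegrE ?powR_ge0 ?invr_ge0 ?(ltW q0).
  have Fy n : rho ^+ n * f n s <= y * s.
    by have := FS n; rewrite lee_fin ler_pdivrMr.
  (* The majorant Y is the l^q sum of all weighted dilates at [s]; the factor [s] undoes the
     division in dt/t. *)
  have e1 : ell s <= C * (y * s) `^ q^-1.
    apply: H => //; first exact: powR_ge0.
      move=> n; apply: key; first by rewrite mulr_gt0.
      by apply: le_trans (Fy n); rewrite ler_wpM2l // lerDl powR_ge0.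
    move=> n; apply: key; first by rewrite mulr_gt0.
    by apply: le_trans (Fy n); rewrite ler_wpM2l // lerDr powR_ge0.
  rewrite -mulrA -[X in _ <= _ * X](powR_Kinv q0 ys0) -powRM ?powR_ge0 ?(ltW C0) //.
  apply: ge0_ler_powR; rewrite ?nnegrE ?mulr_ge0 ?powR_ge0 ?(ltW q0) ?(ltW C0) //.
  exact: (cont_nneg_ge0 He).
rewrite ge0_integralZl_EFin ?(ltW Cq) // integral_nneseries //.
under eq_eseriesr do rewrite intF.
rewrite EFinM -muleA lee_wpmul2l ?lee_fin ?(ltW Cq) //.
rewrite EFinM -muleA; apply: sume_geometric_le; first by rewrite ltW.
by rewrite mule_ge0.
Qed.

(** As K increases, the integrand on [t, 2t] is at least its value with K taken at [t] and the
    powers of the variable at 2t; integrating this constant bounds the weighted K at [t]. *)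
Lemma lq_norm_bounded (q : \bar R) (theta : R) (K : R -> R) : (1 <= q)%E ->
  (forall s t, 0 < s -> s <= t -> K s <= K t) -> (forall t, 0 < t -> 0 <= K t) ->
  cont_nneg (fun t => t `^ (- theta) * K t) -> 0 <= theta ->
  (lq_norm q (fun t => (t `^ (- theta) * K t)%R) < +oo)%E ->
  exists2 M : R, 0 <= M & forall t, 0 < t -> t `^ (- theta) * K t <= M.
Proof.
move=> q1 Kmono K0 Hg th0; case: q q1 => [q||] //=; last first.
  move=> _; set S := ereal_sup _ => Soo.
  have ub t : 0 < t -> ((t `^ (- theta) * K t)%:E <= S)%E.
    by move=> t0; apply: ereal_sup_ubound; exists t => //=; rewrite in_itv /= andbT.
  have S0 : (0 <= S)%E.
    by apply: le_trans (ub 1 ltr01); rewrite lee_fin mulr_ge0 ?powR_ge0 ?K0.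
  case: S S0 ub Soo => [r||] // r0 ub _; by exists r.
rewrite lee_fin => q1; have q0 : 0 < q by lra.
have P := cont_nneg_powR q0 Hg.
move=> /lty_poweRy; rewrite invr_eq0 gt_eqF // => /(_ isT).
set J := (\int[mu]_(t in _) _)%E.
have J0 : (0 <= J)%E by exact: haar_integral_ge0.
move=> Joo; have [j Jj] : exists j, J = j%:E by exists (fine J); rewrite fineK // ge0_fin_numE.
have j0 : 0 <= j by rewrite -lee_fin -Jj.
(* 2^theta compares the weights at [t] and 2t; 2j comes from a^q/2 <= j, with interval length [t]
   and density at least 1/(2t). *)
exists (2 `^ theta * (2 * j) `^ q^-1); first by rewrite mulr_ge0 ?powR_ge0.
move=> t t0; pose a := (2 * t) `^ (- theta) * K t.
have a0 : 0 <= a by rewrite mulr_ge0 ?powR_ge0 ?K0.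
have aE : t `^ (- theta) * K t = 2 `^ theta * a.
  rewrite /a powRM ?(ltW t0) // mulrA mulrA -powRD ?subrr ?powRr0 ?mul1r //.
  by rewrite pnatr_eq0 implybT.
rewrite aE ler_wpM2l ?powR_ge0 //.
have : ((a `^ q / (2 * t) * t)%:E <= j%:E)%E.
  rewrite -Jj; have tt : t < 2 * t by lra.
  pose t2 := 2 * t; pose g x := (x `^ (- theta) * K x) `^ q / x.
  have sub : `[t, t2]%classic `<=` `]0, +oo[%classic.
    by move=> x; rewrite /= !in_itv /= andbT => /andP[tx _]; apply: lt_le_trans tx.
  have mg := measurable_haar P.
  apply: (@le_trans _ _ (\int[mu]_(x in `[t, t2]) (g x)%:E)%E); last first.
    apply: ge0_subset_integral => //.
    by move=> x; exact: (haar_ge0 P).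
  pose a1 := a `^ q / (2 * t).
  have -> : (a `^ q / (2 * t) * t)%:E = (\int[mu]_(x in `[t, t2]) a1%:E)%E.
    rewrite integral_cst //= lebesgue_measure_itv /= lte_fin tt -EFinD -EFinM.
    by congr EFin; rewrite /a1 /t2; ring.
  apply: ge0_le_integral => //.
  - by move=> x _; rewrite lee_fin divr_ge0 ?powR_ge0 // mulr_ge0 // ltW.
  - by apply: (measurable_funS _ sub mg).
  move=> x; rewrite /= in_itv /= => /andP[tx xt]; rewrite lee_fin.
  have x0 : 0 < x by apply: lt_le_trans tx.
  apply: ler_pM; rewrite ?powR_ge0 ?invr_ge0 ?mulr_ge0 ?(ltW t0) //; last first.
    by rewrite lef_pV2 ?posrE ?mulr_gt0.
  apply: ge0_ler_powR; rewrite ?nnegrE ?(ltW q0) ?mulr_ge0 ?powR_ge0 ?K0 //.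
  apply: ler_pM; rewrite ?powR_ge0 ?K0 // ?Kmono //.
  rewrite !powRN lef_pV2 ?posrE ?powR_gt0 ?mulr_gt0 //.
  by apply: ge0_ler_powR; rewrite ?nnegrE ?mulr_ge0 ?(ltW t0) ?(ltW x0).
rewrite lee_fin => aj.
rewrite -(powR_invK q0 a0); apply: ge0_ler_powR;
  rewrite ?nnegrE ?powR_ge0 ?invr_ge0 ?(ltW q0) ?mulr_ge0 //.
move: aj; have -> : a `^ q / (2 * t) * t = a `^ q / 2 by field; rewrite gt_eqF.
by lra.
Qed.

End WeightedNorm.

(** * Reiteration for the interpolation norms *)

Section Reiteration.
Context (R : realType) (E : completeNormedModType R) (T : R -> R -> E -> E).
Hypothesis hT : is_axb_contraction_rep T.

Lemma cont_nneg_Kfun k1 k2 (theta : R) f : Er T k1 f ->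
  cont_nneg (fun t => t `^ (- theta) * Kfun T k1 k2 t f).
Proof.
move=> Ef t t0; split; first by rewrite mulr_ge0 ?powR_ge0 // (Kfun_ge0 hT) // ltW.
have ct : {for t, continuous (fun x : R => x `^ (- theta))}.
  apply: differentiable_continuous; apply/derivable1_diffP.
  by have D := is_derive1_powR (- theta) t0; exact: ex_derive.
by apply: cvgM; [exact: ct | exact: (Kfun_continuous hT)].
Qed.

Lemma powR_expr (s a : R) n : 0 < s -> (s ^+ n) `^ a = s `^ (n%:R * a).
Proof. by move=> s0; rewrite powRrM powR_mulrn // ltW. Qed.

Context (r k1 k2 : nat) (alpha : R).
Hypotheses (k1a : k1%:R < alpha) (ak2 : alpha < k2%:R) (k2r : (k2 <= r)%N).

Let k12 : (k1 < k2)%N.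
Proof. by have := lt_trans k1a ak2; rewrite ltr_nat. Qed.

Let r0 : (0 < r)%N. Proof. by apply: leq_trans k2r; apply: leq_ltn_trans k12. Qed.

(** The two weighted K-functionals [gK] and [gL] in a common variable [s], with t = s^r in the first
    and t = s^(k2-k1) in the second; both then scale with [alpha] itself. *)
Let kap f s := s `^ (- alpha) * Kfun T 0 r (s ^+ r) f.
Let ell f s := s `^ (k1%:R - alpha) * Kfun T k1 k2 (s ^+ (k2 - k1)) f.
Let gK f t := t `^ (- (alpha / r%:R)) * Kfun T 0 r t f.
Let gL f t := t `^ (- ((alpha - k1%:R) / (k2%:R - k1%:R))) * Kfun T k1 k2 t f.

Let kapE f s : 0 < s -> kap f s = gK f (s ^+ r).
Proof.
move=> s0; rewrite /kap /gK powR_expr //; congr (_ `^ _ * _).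
by field; rewrite pnatr_eq0 -lt0n.
Qed.

Let ellE f s : 0 < s -> ell f s = gL f (s ^+ (k2 - k1)).
Proof.
move=> s0; rewrite /ell /gL powR_expr // natrB ?(ltnW k12) //; congr (_ `^ _ * _).
by field; rewrite subr_eq0 eqr_nat gtn_eqF.
Qed.

Lemma reiteration_le (q : \bar R) : (1 <= q)%E -> exists2 C : R, 0 < C & forall f, Er T k1 f ->
  (interp_norm T 0 r (alpha / r%:R) q f <=
   C%:E * interp_norm T k1 k2 ((alpha - k1%:R) / (k2%:R - k1%:R)) q f)%E.
Proof.
move=> q1.
have [C C0 HC] := Kfun_0r_le hT (ltnW k12) k2r.
have [a a0 Ha] := lq_norm_expr r.-1 q1.
have [b b0 Hb] := lq_norm_expr (k2 - k1).-1 q1.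
have km : (0 < k2 - k1)%N by rewrite subn_gt0.
rewrite (prednK r0) in Ha; rewrite (prednK km) in Hb.
exists (a^-1 * (C * b)) => [|f Ef]; first by rewrite !mulr_gt0 // invr_gt0.
have cK : cont_nneg (gK f) by apply: cont_nneg_Kfun; exact: Er0.
have cL : cont_nneg (gL f) by exact: cont_nneg_Kfun.
have ck : cont_nneg (kap f).
  apply: (@cont_nneg_eq R (fun s => gK f (1 * s ^+ r))); last exact: cont_nneg_monomial.
  by move=> s s0; rewrite kapE // mul1r.
have cl : cont_nneg (ell f).
  apply: (@cont_nneg_eq R (fun s => gL f (1 * s ^+ (k2 - k1)))); last exact: cont_nneg_monomial.
  by move=> s s0; rewrite ellE // mul1r.
have le1 : (lq_norm q (kap f) <= C%:E * lq_norm q (ell f))%E.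
  apply: lq_norm_le => //; first exact: ltW.
  move=> s s0; rewrite /kap /ell powRD; last by rewrite (gt_eqF s0) implybT.
  have := ler_wpM2l (powR_ge0 s (- alpha)) (HC f s Ef s0).
  by rewrite powR_mulrn ?(ltW s0) //; lra.
rewrite (lq_norm_eq q (kapE f)) (Ha _ cK) (lq_norm_eq q (ellE f)) (Hb _ cL) in le1.
have ai : 0 <= a^-1 by rewrite invr_ge0 ltW.
have := @lee_wpmul2l R a^-1%:E _ _ _ le1.
rewrite lee_fin => /(_ ai).
by rewrite !muleA -!EFinM mulVf ?gt_eqF // mul1e -mulrA.
Qed.

Lemma reiteration_ge (q : \bar R) : (1 <= q)%E -> exists2 C : R, 0 < C & forall f,
  (interp_norm T 0 r (alpha / r%:R) q f < +oo)%E ->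
  Er T k1 f /\ (interp_norm T k1 k2 ((alpha - k1%:R) / (k2%:R - k1%:R)) q f <=
   C%:E * interp_norm T 0 r (alpha / r%:R) q f)%E.
Proof.
move=> q1.
pose b : R := 2 `^ alpha.
have b1 : 2 ^+ k1 < b.
  by rewrite -powR_mulrn // /b /powR pnatr_eq0 /= ltr_expR ltr_pM2r // ln_gt0 // ltr1n.
have b2 : b < 2 ^+ k2.
  by rewrite -powR_mulrn // /b /powR pnatr_eq0 /= ltr_expR ltr_pM2r // ln_gt0 // ltr1n.
have bp : 0 < b by rewrite powR_gt0.
have [m [C [m0 m1 C0 HC]]] := Kfun_reiteration hT k2r b1 b2.
have hm : 0 < m < 1 by rewrite m0.
have [C' C'0 HC'] := lq_norm_dilates q1 hm C0.
have [a a0 Ha] := lq_norm_expr r.-1 q1.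
have [c c0 Hc] := lq_norm_expr (k2 - k1).-1 q1.
have km : (0 < k2 - k1)%N by rewrite subn_gt0.
rewrite (prednK r0) in Ha; rewrite (prednK km) in Hc.
exists (c^-1 * (C' * a)) => [|f fin]; first by rewrite !mulr_gt0 // invr_gt0.
have cK : cont_nneg (gK f) by apply: cont_nneg_Kfun; exact: Er0.
have ck : cont_nneg (kap f).
  apply: (@cont_nneg_eq R (fun s => gK f (1 * s ^+ r))); last exact: cont_nneg_monomial.
  by move=> s s0; rewrite kapE // mul1r.
have step s Y : 0 < s -> 0 <= Y -> (forall n, m ^+ n * kap f (2 ^+ n * s) <= Y) ->
    (forall n, m ^+ n * kap f ((2 ^+ n.+1)^-1 * s) <= Y) -> Er T k1 f /\ ell f s <= C * Y.
  move=> s0 Y0 Hup Hdn.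
  have sa : 0 < s `^ alpha by rewrite powR_gt0.
  have p2 n : 0 < 2 ^+ n :> R by rewrite exprn_gt0.
  have b2n n : (2 ^+ n) `^ alpha = b ^+ n.
    by rewrite -powR_mulrn // -powRrM mulrC powRrM powR_mulrn // ltW.
  have kapK t : 0 < t -> Kfun T 0 r (t ^+ r) f = t `^ alpha * kap f t.
    move=> t0; rewrite /kap mulrA -powRD ?subrr ?powRr0 ?mul1r //.
    by rewrite (gt_eqF t0) implybT.
  (* The bound is multiplied by s^alpha because K((2^n s)^r) = b^n s^alpha kap(2^n s) with b =
     2^alpha, and likewise at the smaller scales. *)
  have [|n|n|Ef B] := HC f s (s `^ alpha * Y) s0.
  - by rewrite mulr_ge0 // ltW.
  - rewrite kapK ?mulr_gt0 // powRM ?(ltW s0) ?(ltW (p2 n)) // b2n.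
    have := ler_wpM2l (ltW (mulr_gt0 (exprn_gt0 n bp) sa)) (Hup n); lra.
  - have p := p2 n.+1; have q0 : 0 < (2 ^+ n.+1)^-1 * s by rewrite mulr_gt0 // invr_gt0.
    rewrite [s / _]mulrC kapK // powRM ?invr_ge0 ?(ltW s0) ?(ltW p) //.
    have -> : (2 ^+ n.+1)^-1 `^ alpha = (b ^+ n.+1)^-1.
      by rewrite -b2n -powR_inv1 ?(ltW p) // -powRrM mulN1r powRN.
    have bn : 0 < (b ^+ n.+1)^-1 by rewrite invr_gt0 exprn_gt0.
    have := ler_wpM2l (ltW (mulr_gt0 bn sa)) (Hdn n); lra.
  split => //.
  have -> : ell f s = (s `^ alpha)^-1 * (s ^+ k1 * Kfun T k1 k2 (s ^+ (k2 - k1)) f).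
    rewrite /ell powRD; last by rewrite (gt_eqF s0) implybT.
    by rewrite powRN powR_mulrn ?(ltW s0) //; ring.
  by rewrite ler_pdivrMl // (le_trans B) // le_eqVlt; apply/orP; left; apply/eqP; ring.
(* A uniform bound serves as Y at s = 1 and places [f] in E^k1; only then is [gL f] known to be
   continuous, so that its norm can be estimated. *)
have [M M0 HM] : exists2 M : R, 0 <= M & forall t, 0 < t -> gK f t <= M.
  apply: (lq_norm_bounded q1 _ _ cK _ fin).
  - move=> s t s0 st; apply: (Kfun_mono hT); first exact: Er0.
    by rewrite (ltW s0).
  - by move=> t t0; apply: (Kfun_ge0 hT); [exact: ltW | exact: Er0].
  - by rewrite divr_ge0 // (le_trans _ (ltW k1a)).
have mk n t : 0 < t -> m ^+ n * kap f t <= M.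
  move=> t0; have kM : kap f t <= M by rewrite kapE // HM // exprn_gt0.
  rewrite (le_trans _ kM) // ler_piMl ?(cont_nneg_ge0 ck) //.
  by rewrite exprn_ile1 // ltW.
have [Ef _] : Er T k1 f /\ ell f 1 <= C * M.
  by apply: step => // n; apply: mk; rewrite mulr1 ?invr_gt0 exprn_gt0.
split => //.
have cL : cont_nneg (gL f) by exact: cont_nneg_Kfun.
have cl : cont_nneg (ell f).
  apply: (@cont_nneg_eq R (fun s => gL f (1 * s ^+ (k2 - k1)))); last exact: cont_nneg_monomial.
  by move=> s s0; rewrite ellE // mul1r.
have le1 := HC' _ _ ck cl (fun s Y s0 Y0 H1 H2 => (step s Y s0 Y0 H1 H2).2).
rewrite (lq_norm_eq q (kapE f)) (Ha _ cK) (lq_norm_eq q (ellE f)) (Hc _ cL) in le1.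
have ci : 0 <= c^-1 by rewrite invr_ge0 ltW.
have := @lee_wpmul2l R c^-1%:E _ _ _ le1.
rewrite lee_fin => /(_ ci).
by rewrite !muleA -!EFinM mulVf ?gt_eqF // mul1e -mulrA.
Qed.

End Reiteration.

Unset Implicit Arguments.

Theorem mainTheorem4 (R : realType) (E : completeNormedModType R)
    (T : R -> R -> E -> E) (r : nat) (q : \bar R) (k1 k2 : nat) (alpha : R) :
  is_axb_contraction_rep T ->
  (1 <= q)%E ->
  k1%:R < alpha -> alpha < k2%:R -> (k2 <= r)%N ->
  interp_space T 0 r (alpha / r%:R) q
    = interp_space T k1 k2 ((alpha - k1%:R) / (k2%:R - k1%:R)) q /\
  exists c C : R, 0 < c /\ 0 < C /\
    forall f, interp_space T 0 r (alpha / r%:R) q f ->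
      (c%:E * interp_norm T k1 k2 ((alpha - k1%:R) / (k2%:R - k1%:R)) q f
         <= interp_norm T 0 r (alpha / r%:R) q f)%E /\
      (interp_norm T 0 r (alpha / r%:R) q f
         <= C%:E * interp_norm T k1 k2 ((alpha - k1%:R) / (k2%:R - k1%:R)) q f)%E.
Proof.
move=> hT q1 k1a ak2 k2r.
have [C C0 HC] := reiteration_le hT k1a ak2 k2r q1.
have [D D0 HD] := reiteration_ge hT k1a ak2 k2r q1.
have mfin (x : R) (y : \bar R) : 0 < x -> (y < +oo)%E -> (x%:E * y < +oo)%E.
  move=> x0; case: y => [y||] // _; first by rewrite -EFinM ltry.
  by rewrite gt0_muleNy ?lte_fin.
split.
  apply/seteqP; split=> f /= [Ef fin].
    by have [Ek le] := HD f fin; split => //; apply: le_lt_trans le _; exact: mfin.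
  by split; [exact: Er0 | apply: le_lt_trans (HC f Ef) _; exact: mfin].
exists D^-1, C; split; first by rewrite invr_gt0.
split => // f [_ fin]; have [Ek le] := HD f fin; split; last exact: HC.
have Di : (0 <= (D^-1)%:E)%E by rewrite lee_fin invr_ge0 ltW.
have := lee_wpmul2l Di le.
by rewrite muleA -EFinM mulVf ?gt_eqF // mul1e.
Qed.
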